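(* Suppose that $$\sum_{k=0}^{\infty}\bigl(1-F_\mu(k)\bigr)^2<\infty .$$ Then the process of reflections $(R_k)$ is positive recurrent on $C(x_0)$ for each starting point $x_0\ge 0$. If in addition $\mathsf{E}(Y_1)=\sum_{k\ge 0}k\,\mu(k)<\infty$, then the reflected random walk $(X_n)$ is also positive recurrent on $C(x_0)$, while it is null recurrent on $C(x_0)$ when $\mathsf{E}(Y_1)=\infty$.
   Context: Let $(Y_n)_{n\ge 1}$ be i.i.d. non-constant random variables with values in $\mathbb{N}_0=\{0,1,2,\dots\}$ and common distribution $\mu$, with distribution function $F_\mu(x)=\mu([0,x])$; write $\mu(k)=\mu(\{k\})$. Reflected random walk is the Markov chain on $[0,\infty)$ given by $X_0=x_0\ge 0$ and $X_{n+1}=|X_n-Y_{n+1}|$. Put $d=\gcd\operatorname{supp}(\mu)$ and $N=\sup\operatorname{supp}(\mu)\in(0,\infty]$. For $x_0\ge0$ let $S(x_0)=\{kd\pm x_0: k\in\mathbb{Z}\}\cap[0,\infty)$ and $C(x_0)=S(x_0)\cap[0,N]$ (with $C(x_0)=S(x_0)$ if $N=\infty$). It is known that $C(x_0)$ is an essential (irreducible and absorbing) class for $(X_n)$, into which $(X_n)$ started at $x_0$ is absorbed after finitely many steps. Reflection times: $r(0)=0$ and $r(k+1)=\inf\{n>r(k): X_n=-(X_{n-1}-Y_n)\}=\inf\{n>r(k): Y_{r(k)+1}+\dots+Y_n\ge X_{r(k)}\}$; these are almost surely finite. The process of reflections is the Markov chain $R_k=X_{r(k)}$. Positive and null recurrence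 on $C(x_0)$ are in the usual sense of denumerable irreducible Markov chains. *)

(* Defs.v *)
(* MathComp / MathComp-Analysis *)
From HB Require Import structures.
From mathcomp Require Export all_boot all_order all_algebra.
From mathcomp Require Export all_classical all_reals all_analysis.

Set Implicit Arguments.
Unset Strict Implicit.
Unset Printing Implicit Defensive.

Export Order.TTheory GRing.Theory Num.Theory.

Local Open Scope classical_set_scope.
Local Open Scope ring_scope.

Section laws_on_nat.
Context {R : realType} (mu : probability nat R).

Definition supp : set nat := [set k | (0 < mu [set k])%E].

Definition nonconstant : Prop := ~ exists c : nat, mu [set c] = 1%E.

Definition F_mu (k : nat) : \bar R := mu [set j | (j <= k)%N].

Definition mean : \bar R := (\sum_(0 <= k <oo) k%:R%:E * mu [set k])%E.

End laws_on_nat.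

Definition is_gcd (A : set nat) (d : nat) : Prop :=
  (forall a, A a -> (d %| a)%N) /\
  (forall e, (forall a, A a -> (e %| a)%N) -> (e %| d)%N).

Definition gcd_set (A : set nat) : nat := xget 0%N [set d | is_gcd A d].

(* The default value of [xget] is never used: every set of naturals, even an
   infinite one, has a gcd. *)
Lemma gcd_setP (A : set nat) : is_gcd A (gcd_set A).
Proof.
suff [d hd] : exists d, is_gcd A d by rewrite /gcd_set; case: xgetP => [|/(_ d)].
pose B g := (0 < g)%N /\
  (forall e, (forall a, A a -> (e %| a)%N) -> (e %| g)%N).
have [[a0 [Aa0 a0gt0]]|A0] := pselect (exists a, A a /\ (0 < a)%N).
  have exB : exists g, `[< B g >].
    by exists a0; apply/asboolP; split=> // e; exact.
  case: (ex_minnP exB) => g /asboolP[g_gt0 gdiv] gmin.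
  exists g; split=> // a Aa.
  suff /gmin : `[< B (gcdn g a) >].
    move=> le_g; have : gcdn g a = g.
      by apply/eqP; rewrite eqn_leq le_g dvdn_leq// dvdn_gcdl.
    by move=> <-; exact: dvdn_gcdr.
  apply/asboolP; split; first by rewrite gcdn_gt0 g_gt0.
  by move=> e he; rewrite dvdn_gcd gdiv//= he.
exists 0%N; split=> // a Aa.
by rewrite dvd0n; apply: contra_notT A0 => a_neq0; exists a; rewrite lt0n.
Qed.

Section state_space.
Context {R : realType} (mu : probability nat R).

Definition S_set (x0 : R) : set R :=
  [set y | 0 <= y /\ exists k : int,
     y = k%:~R * (gcd_set (supp mu))%:R + x0 \/
     y = k%:~R * (gcd_set (supp mu))%:R - x0].

Definition supN : \bar R := ereal_sup [set k%:R%:E | k in supp mu].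

Definition C_set (x0 : R) : set R :=
  [set y | S_set x0 y /\ (y%:E <= supN)%E].

End state_space.

(* First element of a set of times; [None] stands for an infinite time. *)
Definition first (A : set nat) : option nat :=
  match pselect (exists n, `[< A n >]) with
  | left h => Some (ex_minn h)
  | right _ => None
  end.

Definition ext_time {R : realType} (t : option nat) : \bar R :=
  if t is Some n then n%:R%:E else +oo%E.

Section processes.
Context {disp : measure_display} {T : measurableType disp} {R : realType}.
Variables (P : probability T R) (Y : nat -> {RV P >-> nat}).

Definition mutually_independent : Prop :=
  forall (s : seq nat) (A : nat -> set nat), uniq s ->
    P (\bigcap_(i in [set` s]) (Y i @^-1` A i)) =
    (\prod_(i <- s) P (Y i @^-1` A i))%E.

Definition iid_with_law (mu : probability nat R) : Prop :=
  mutually_independent /\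
  forall (n : nat) (A : set nat), distribution P (Y n) A = mu A.

(* The sequence is indexed from 0: [Y n] is the (n+1)-st increment. *)
Fixpoint walk (x : R) (n : nat) (w : T) : R :=
  if n is m.+1 then `|walk x m w - (Y m w)%:R| else x.

(* [reflects x w n]: n >= 1 and the n-th step of the walk is a reflection. *)
Definition reflects (x : R) (w : T) (n : nat) : Prop :=
  if n is m.+1 then walk x m.+1 w = - (walk x m w - (Y m w)%:R) else False.

Fixpoint reflection_time (x : R) (k : nat) (w : T) : option nat :=
  if k is j.+1 then
    if reflection_time x j w is Some m
    then first [set n | (m < n)%N /\ reflects x w n]
    else None
  else Some 0%N.

(* When the k-th reflection time is infinite (a null event) the process is sent
   to -1, which lies outside [0, +oo[ and so is never mistaken for a visit. *)
Definition reflection_process (x : R) (k : nat) (w : T) : R :=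
  if reflection_time x k w is Some n then walk x n w else -1.

End processes.

(* A Markov chain is given by its realizations [Z x n w] from every starting
   state [x], so that an event for [Z x] under [P] has the probability usually
   written with P_x. *)
Section recurrence.
Context {disp : measure_display} {T : measurableType disp} {R : realType}.
Variables (P : probability T R) (Z : R -> nat -> T -> R).

Definition return_time (x : R) (w : T) : option nat :=
  first [set n | (0 < n)%N /\ Z x n w = x].

Definition recurrent_state (x : R) : Prop :=
  P [set w | return_time x w] = 1%E.

Definition mean_return_time (x : R) : \bar R :=
  (\int[P]_w ext_time (return_time x w))%E.

Definition absorbing (C : set R) : Prop :=
  forall x, C x -> P [set w | C (Z x 1%N w)] = 1%E.

Definition irreducible (C : set R) : Prop :=
  forall x y, C x -> C y -> exists n : nat, (0 < P [set w | Z x n w = y])%E.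

Definition essential_class (C : set R) : Prop :=
  C !=set0 /\ absorbing C /\ irreducible C.

Definition positive_recurrent_on (C : set R) : Prop :=
  essential_class C /\
  forall x, C x -> recurrent_state x /\ (mean_return_time x < +oo)%E.

Definition null_recurrent_on (C : set R) : Prop :=
  essential_class C /\
  forall x, C x -> recurrent_state x /\ mean_return_time x = +oo%E.

End recurrence.

(* Main.v *)
Require Import Defs.
From mathcomp Require Import all_boot all_order all_algebra.
From mathcomp Require Import all_classical all_reals all_analysis.
From mathcomp Require Import measurable_realfun zify ring lra.

Set Implicit Arguments.
Unset Strict Implicit.
Unset Printing Implicit Defensive.

Import Order.TTheory GRing.Theory Num.Theory.

Local Open Scope classical_set_scope.
Local Open Scope ring_scope.

(** Let p be the law of the increments. A step of the walk from y is reflected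
when y <= Y and free otherwise. Let nu be the measure on the points of S(x0)
with density proportional to W(x) = P(Y > x) + P(Y >= x) for x > 0 and
W(0) = P(Y > 0). It is invariant for the walk: after the symmetrization in an
independent pair of increments this is an identity between sums of an even
function over intervals ([exchange_steps], [stationary_walk]). Let rho be the
image of nu under one reflected step. It is invariant for the process of
reflections ([reflected_invariant]), and its total mass is the sum of
W(x) P(Y >= x). This is at most a constant multiple of 1 + E(min(Y, Y')), where
Y' is an independent copy of Y, and E(min(Y, Y')) is the sum of the squares
(1 - F(k))^2 ([reflected_mass_le]): the assumption makes rho finite.

Kac's formula turns invariant measures into mean return times. If I is an
invariant measure of a Markov chain and I({x}) is finite, then the integral
with respect to I(dy) of the probability that the chain started at y visits x
at a positive time is I({x}) times the mean return time to x ([kac_formula]).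
With I = rho it bounds the mean return times of the process of reflections.
With I = nu, whose mass is finite exactly when E(Y) is, it bounds those of the
walk when E(Y) is finite. When E(Y) is infinite, the walk
returns to x because the process of reflections does; by irreducibility x is
then visited almost surely from every state, so the left-hand side is the mass
of nu, which is infinite, while nu({x}) is finite: the mean return time is
infinite.

Irreducibility comes from one large step M of the support: within [0, M] the
flips x -> M - x turn every step s <= M into a rotation by s modulo M
([reach_rotate]), and the steps of the support that are at most M can be taken
to generate gcd(supp) Z ([reach_class]). *)

(** * Unordered sums of extended reals *)

Section esum_complements.
Context {R : realType}.
Local Open Scope ereal_scope.

Lemma adde_cancelr (a b c : \bar R) : c \is a fin_num ->
  a + c = b + c -> a = b.
Proof. by move=> cfin e; rewrite -(addeK a cfin) e addeK. Qed.

Lemma eq_of_le_add (a b a' b' : \bar R) : b \is a fin_num ->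
  a' <= a -> b' <= b -> a' + b' = a + b -> a' = a.
Proof.
move=> bfin aa bb e; apply: le_anti; rewrite aa/=.
by rewrite -(leeD2rE _ _ bfin) -e leeD2l.
Qed.

Lemma esumT_ge0 (I : choiceType) (a : I -> \bar R) :
  (forall i, 0 <= a i) -> 0 <= \esum_(i in setT) a i.
Proof. by move=> a0; exact: esum_ge0. Qed.

Lemma le_term_esum (I : choiceType) (a : I -> \bar R) (i : I) :
  (forall j, 0 <= a j) -> a i <= \esum_(j in setT) a j.
Proof.
move=> a0; apply: esum_ge; exists [set i]; last by rewrite fsbig_set1.
by split => //; exact: finite_set1.
Qed.

Lemma exchange_esum (I J : choiceType) (a : I -> J -> \bar R) :
  (forall i j, 0 <= a i j) ->
  \esum_(i in setT) \esum_(j in setT) a i j =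
  \esum_(j in setT) \esum_(i in setT) a i j.
Proof.
move=> a0; rewrite !esum_esum//.
rewrite (reindex_esum (setT `*`` fun=> setT) _
  (fun z : J * I => (z.2, z.1)))//.
split=> //; first by move=> [i j] [i' j'] _ _ /= [-> ->].
by move=> [i j] _ /=; exists (j, i).
Qed.

(** The infinite factor is allowed: then both sides are 0 or +oo according to
whether all the terms vanish. *)
Lemma esumZl (I : choiceType) (c : \bar R) (a : I -> \bar R) :
  0 <= c -> (forall i, 0 <= a i) ->
  \esum_(i in setT) (c * a i) = c * \esum_(i in setT) a i.
Proof.
have le_fin (r : R) (b : I -> \bar R) : (0 <= r)%R -> (forall i, 0 <= b i) ->
    \esum_(i in setT) (r%:E * b i) <= r%:E * \esum_(i in setT) b i.
  move=> r0 b0; apply: ge_ereal_sup => _ [X [finX _] <-].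
  rewrite -ge0_mule_fsumr//; apply: lee_wpmul2l; first by rewrite lee_fin.
  by apply: esum_ge; exists X.
case: c => [r| |]//; rewrite ?lee_fin => c0 a0.
  have [->|r0] := eqVneq r 0%R.
    by rewrite mul0e esum1// => i _; rewrite mul0e.
  have r_gt0 : (0 < r)%R by rewrite lt_def r0.
  apply/eqP; rewrite eq_le le_fin//=.
  have ra0 i : 0 <= r%:E * a i by rewrite mule_ge0// lee_fin.
  have := le_fin r^-1%R (fun i => r%:E * a i) (ltW _) ra0.
  rewrite invr_gt0 => /(_ r_gt0) le2.
  have -> : \esum_(i in setT) a i = \esum_(i in setT) (r^-1%:E * (r%:E * a i)).
    by apply: eq_esum => i _; rewrite muleA -EFinM mulVf// mul1e.
  apply: (le_trans (lee_wpmul2l _ le2)); first by rewrite lee_fin ltW.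
  by rewrite muleA -EFinM divff// mul1e.
have [ex|nex] := pselect (exists i, 0 < a i).
  case: ex => i ai.
  have E1 : 0 < \esum_(i in setT) a i.
    by apply: (lt_le_trans ai); exact: le_term_esum.
  rewrite gt0_mulye//; apply/eqP; rewrite -leye_eq.
  rewrite -[leLHS](gt0_mulye ai).
  by apply: (le_term_esum (a := fun j => +oo * a j)) => j; rewrite mule_ge0.
have a00 i : a i = 0.
  by apply/eqP; rewrite eq_le a0 andbT leNgt; apply/negP => ai; apply: nex; exists i.
by rewrite !esum1// ?mule0// => i _; rewrite a00 mule0.
Qed.

Lemma esumZr (I : choiceType) (c : \bar R) (a : I -> \bar R) :
  0 <= c -> (forall i, 0 <= a i) ->
  \esum_(i in setT) (a i * c) = (\esum_(i in setT) a i) * c.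
Proof.
by move=> c0 a0; rewrite muleC -esumZl//; apply: eq_esum => i _; rewrite muleC.
Qed.

Lemma esum_split1 (I : choiceType) (a : I -> \bar R) (i : I) :
  (forall j, 0 <= a j) ->
  \esum_(j in setT) a j = a i + \esum_(j in setT) (if j == i then 0 else a j).
Proof.
move=> a0.
rewrite (esumID [set i])//; congr (_ + _); first by rewrite setTI esum_set1.
rewrite setTI esum_mkcond; apply: eq_esum => j _.
case: ifPn => [|]; first by rewrite inE /= => /eqP /negbTE ->.
by rewrite notin_setE /= => /contrapT ->; rewrite eqxx.
Qed.

Lemma esum_single (I : choiceType) (a : I -> \bar R) (i : I) :
  (forall j, j != i -> a j = 0) -> 0 <= a i ->
  \esum_(j in setT) a j = a i.
Proof.
move=> a0 ai0; rewrite (esum_split1 i); last first.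
  by move=> j; have [->|/a0 ->] := eqVneq j i.
by rewrite esum1 ?adde0// => j _; case: eqVneq => // /a0.
Qed.

Lemma esum_eq0 (I : choiceType) (a : I -> \bar R) :
  (forall i, 0 <= a i) -> \esum_(i in setT) a i = 0 -> forall i, a i = 0.
Proof.
move=> a0 s0 i; apply/eqP; rewrite eq_le a0 andbT -s0.
exact: le_term_esum.
Qed.

Lemma esum_nat_le (a : nat -> \bar R) (b : \bar R) :
  (forall i, 0 <= a i) ->
  (forall n, \sum_(i < n) a i <= b) -> \esum_(i in setT) a i <= b.
Proof.
move=> a0 H; rewrite -nneseries_esumT//; apply: lime_le.
  exact: is_cvg_nneseries.
by apply: nearW => n; rewrite big_mkord.
Qed.

Lemma esum_cst_pinfty (c : \bar R) : 0 < c ->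
  \esum_(n in [set: nat]) c = +oo.
Proof.
move=> c0; have -> : (fun=> c) = (fun n : nat => c * 1) :> (nat -> _).
  by apply/funext => n; rewrite mule1.
rewrite esumZl ?ltW//.
suff -> : \esum_(n in [set: nat]) 1 = +oo :> \bar R by rewrite gt0_muley.
apply/eqyP => r r0.
have [n rn] : exists n : nat, (r <= n%:R)%R.
  by exists (Num.bound r); rewrite ltW// archi_boundP// ltW.
rewrite -nneseries_esumT//.
apply: le_trans (nneseries_lim_ge n _); last by [].
by rewrite big_mkord sumEFin sumr_const card_ord lee_fin.
Qed.


Lemma esum_nat_recl (a : nat -> \bar R) : (forall n, 0 <= a n) ->
  \esum_(n in setT) a n = a 0%N + \esum_(n in setT) a n.+1.
Proof.
move=> a0; rewrite -!nneseries_esumT// nneseries_recl//; congr (_ + _).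
by rewrite -[LHS](nneseries_addn 1)//; apply: eq_eseriesr => n _; rewrite addn1.
Qed.

End esum_complements.

(** * Sum functionals and the Kac formula *)

Section functionals.
Context {R : realType} {S : Type}.
Local Open Scope ereal_scope.
Implicit Types (I J : (S -> \bar R) -> \bar R) (f g : S -> \bar R).

Definition ind (b : bool) : \bar R := if b then 1 else 0.

Lemma ind_ge0 b : 0 <= ind b. Proof. by case: b. Qed.
Lemma ind_le1 b : ind b <= 1. Proof. by case: b => //=; rewrite lee_fin. Qed.

(** The functionals f |-> sum_i a_i f(e_i) with nonnegative weights, that is the
measures with countable support, seen through their action on nonnegative
functions. The abstract form makes composition (measure after kernel, kernel
after kernel) immediate. *)
Record sum_functional I : Prop := SumFunctional {
  functional_ge0 : forall f, (forall x, 0 <= f x) -> 0 <= I f ;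
  functional_le : forall f g, (forall x, 0 <= f x) -> (forall x, f x <= g x) ->
    I f <= I g ;
  functionalD : forall f g, (forall x, 0 <= f x) -> (forall x, 0 <= g x) ->
    I (fun x => f x + g x) = I f + I g ;
  functionalZ : forall c f, 0 <= c -> (forall x, 0 <= f x) ->
    I (fun x => c * f x) = c * I f ;
  functional_esum : forall f : nat -> S -> \bar R, (forall n x, 0 <= f n x) ->
    I (fun x => \esum_(n in setT) f n x) = \esum_(n in setT) I (f n) }.

Lemma functional_eq I f g : sum_functional I -> (forall x, 0 <= f x) ->
  (forall x, f x = g x) -> I f = I g.
Proof.
move=> hI f0 fg; apply/eqP; rewrite eq_le !(functional_le hI)// => x;
  by rewrite -fg.
Qed.

Lemma functional0 I : sum_functional I -> I (fun=> 0) = 0.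
Proof.
move=> hI; rewrite -[RHS](mul0e (I (fun=> 0))) -(functionalZ hI)//.
by apply: functional_eq => // x; rewrite mul0e.
Qed.

Lemma functional_sum I (f : nat -> S -> \bar R) n : sum_functional I ->
  (forall i x, 0 <= f i x) ->
  I (fun x => \sum_(i < n) f i x) = \sum_(i < n) I (f i).
Proof.
move=> hI f0; elim: n => [|n IH].
  rewrite big_ord0 -[RHS](functional0 hI).
  by apply: functional_eq => // x; rewrite big_ord0.
rewrite big_ord_recr /= -IH -functionalD//; last first.
  by move=> x; exact: sume_ge0.
apply: functional_eq => // x; last by rewrite big_ord_recr.
exact: sume_ge0.
Qed.

Lemma functional_eval x : sum_functional (fun f => f x).
Proof. by split. Qed.

Lemma functional_weighted (T : choiceType) (a : T -> \bar R)
    (J : T -> (S -> \bar R) -> \bar R) :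
  (forall t, 0 <= a t) -> (forall t, sum_functional (J t)) ->
  sum_functional (fun f => \esum_(t in setT) (a t * J t f)).
Proof.
move=> a0 hJ; split=> [f f0|f g f0 fg|f g f0 g0|c f c0 f0|f f0].
- by apply: esumT_ge0 => t; rewrite mule_ge0//; exact: (functional_ge0 (hJ t)).
- by apply: le_esum => t _; rewrite lee_wpmul2l//; exact: (functional_le (hJ t)).
- have g0' t := functional_ge0 (hJ t) g0; have f0' t := functional_ge0 (hJ t) f0.
  rewrite -esumD//; try by move=> t _; rewrite mule_ge0.
  by apply: eq_esum => t _; rewrite (functionalD (hJ t))// ge0_muleDr.
- have f0' t := functional_ge0 (hJ t) f0.
  rewrite -esumZl//; last by move=> t; rewrite mule_ge0.
  by apply: eq_esum => t _; rewrite (functionalZ (hJ t))// muleCA.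
- have f0' t n := functional_ge0 (hJ t) (f0 n).
  rewrite exchange_esum; last by move=> n t; rewrite mule_ge0.
  by apply: eq_esum => t _; rewrite (functional_esum (hJ t))// esumZl.
Qed.

Lemma functional_comp I (K : S -> (S -> \bar R) -> \bar R) :
  sum_functional I -> (forall x, sum_functional (K x)) ->
  sum_functional (fun f => I (fun x => K x f)).
Proof.
move=> hI hK; split=> [f f0|f g f0 fg|f g f0 g0|c f c0 f0|f f0].
- by apply: (functional_ge0 hI) => x; exact: (functional_ge0 (hK x)).
- apply: (functional_le hI) => x; first exact: (functional_ge0 (hK x)).
  exact: (functional_le (hK x)).
- have g0' t := functional_ge0 (hK t) g0; have f0' t := functional_ge0 (hK t) f0.
  rewrite -(functionalD hI)//; apply: functional_eq => // x.
    by apply: (functional_ge0 (hK x)) => y; rewrite adde_ge0.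
  by rewrite (functionalD (hK x)).
- have f0' t := functional_ge0 (hK t) f0.
  rewrite -(functionalZ hI)//; apply: functional_eq => // x.
    by apply: (functional_ge0 (hK x)) => y; rewrite mule_ge0.
  by rewrite (functionalZ (hK x)).
- have f0' t n := functional_ge0 (hK t) (f0 n).
  rewrite -(functional_esum hI)//; apply: functional_eq => // x.
    by apply: (functional_ge0 (hK x)) => y; exact: esumT_ge0.
  by rewrite (functional_esum (hK x)).
Qed.

Lemma functional_series (T : choiceType) (J : T -> (S -> \bar R) -> \bar R) :
  (forall t, sum_functional (J t)) ->
  sum_functional (fun f => \esum_(t in setT) J t f).
Proof.
move=> hJ.
have -> : (fun f => \esum_(t in setT) J t f) =
          (fun f => \esum_(t in setT) (1 * J t f)).
  by apply/funext => f; apply: eq_esum => t _; rewrite mul1e.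
exact: functional_weighted.
Qed.

Lemma functional_add (I J : (S -> \bar R) -> \bar R) :
  sum_functional I -> sum_functional J ->
  sum_functional (fun f => I f + J f).
Proof.
move=> hI hJ; split=> [f f0|f g f0 fg|f g f0 g0|c f c0 f0|f f0].
- by rewrite adde_ge0//; [exact: (functional_ge0 hI)|exact: (functional_ge0 hJ)].
- by apply: leeD; [exact: (functional_le hI)|exact: (functional_le hJ)].
- by rewrite (functionalD hI)// (functionalD hJ)// addeACA.
- rewrite (functionalZ hI)// (functionalZ hJ)// ge0_muleDr//.
    exact: (functional_ge0 hI).
  exact: (functional_ge0 hJ).
- rewrite (functional_esum hI)// (functional_esum hJ)// esumD// => n _.
    exact: (functional_ge0 hI).
  exact: (functional_ge0 hJ).
Qed.

End functionals.

Section kac.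
Context {R : realType} {S : eqType}.
Local Open Scope ereal_scope.
Variables (I : (S -> \bar R) -> \bar R) (K : S -> (S -> \bar R) -> \bar R).
Hypothesis hI : sum_functional I.
Hypothesis invariant : forall f, (forall y, 0 <= f y <= 1) ->
  I (fun y => K y f) = I f.
Variables (x : S) (F : nat -> S -> \bar R).
Hypothesis F01 : forall k y, 0 <= F k y <= 1.
Hypothesis F0 : forall y, F 0%N y = K y (fun z => ind (z == x)).
Hypothesis FS : forall k y, F k.+1 y = K y (fun z => ind (z != x) * F k z).

(** F k y stands for the probability that the chain started at y first visits x
at time k + 1. By invariance the I-measure of first visiting x at time k + 2 is
the I-measure of being away from x and then first visiting x at time k + 1;
what is lost between two consecutive levels is the contribution of the start at
x, that is I({x}) F k x. *)
Lemma kac_level k :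
  I (F k) + I (fun z => ind (z == x)) * \sum_(j < k) F j x
  = I (fun z => ind (z == x)).
Proof.
have Fge0 j y : 0 <= F j y by case/andP: (F01 j y).
have ind01 y (b : bool) : 0 <= ind b * F y.1 y.2 <= 1.
  rewrite mule_ge0 ?ind_ge0//=; case: b => /=; rewrite ?mul1e ?mul0e//.
  by case/andP: (F01 y.1 y.2).
elim: k => [|k IH].
  rewrite big_ord0 mule0 adde0 -[RHS]invariant; last first.
    by move=> y; rewrite ind_ge0 ind_le1.
  by apply: functional_eq => // y; rewrite F0.
rewrite big_ord_recr /= -[RHS]IH.
rewrite ge0_muleDr ?sume_ge0//= addeA [LHS]addeAC; congr (_ + _).
have -> : I (F k.+1) = I (fun z => ind (z != x) * F k z).
  rewrite -[RHS]invariant; last by move=> y; exact: (ind01 (k, y)).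
  by apply: functional_eq => // y; rewrite FS.
rewrite muleC -(functionalZ hI)//; last by move=> y; exact: ind_ge0.
rewrite -(functionalD hI)//; last 2 first.
- by move=> y; rewrite mule_ge0 ?ind_ge0.
- by move=> y; rewrite mule_ge0 ?ind_ge0.
apply: functional_eq => // y.
  by rewrite adde_ge0 ?mule_ge0 ?ind_ge0.
by case: eqVneq => [->|] /=; rewrite ?mul0e ?mul1e ?mule0 ?mule1 ?add0e ?adde0.
Qed.

(** Here u k is the probability that the return time to x exceeds k, so that the
last sum is the mean return time. *)
Lemma kac_formula (u : nat -> \bar R) :
  I (fun z => ind (z == x)) < +oo ->
  (forall k, 0 <= u k) -> (forall k, u k + \sum_(j < k) F j x = 1) ->
  I (fun y => \esum_(k in setT) F k y)
  = I (fun z => ind (z == x)) * \esum_(k in setT) u k.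
Proof.
move=> fin u0 uF.
have Fge0 j y : 0 <= F j y by case/andP: (F01 j y).
have I0 : 0 <= I (fun z => ind (z == x)).
  by apply: (functional_ge0 hI) => y; exact: ind_ge0.
rewrite (functional_esum hI)// -esumZl//; apply: eq_esum => k _.
have Sfin : \sum_(j < k) F j x \is a fin_num.
  rewrite ge0_fin_numE ?sume_ge0//; apply: le_lt_trans (ltry 1).
  by rewrite -(uF k) leeDr.
have Ifin : I (fun z => ind (z == x)) \is a fin_num by rewrite ge0_fin_numE.
have := kac_level k; rewrite -[RHS]mule1 -(uF k).
by rewrite ge0_muleDr ?sume_ge0//; apply: adde_cancelr; exact: fin_numM.
Qed.

End kac.

(** * Return times *)

Lemma firstP (A : set nat) n :
  first A = Some n <-> A n /\ forall m, (m < n)%N -> ~ A m.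
Proof.
rewrite /first; case: pselect => [ex|nex]; last first.
  by split=> // -[An _]; case: nex; exists n; apply/asboolP.
case: ex_minnP => m /asboolP Am min_m; split=> [[<-]|[An lt_n]].
  split=> // j jm Aj; have /min_m : `[< A j >] by apply/asboolP.
  by rewrite leqNgt jm.
congr Some; apply/eqP; rewrite eqn_leq min_m; last exact/asboolP.
by rewrite leqNgt; apply/negP => mn; exact: (lt_n m mn).
Qed.

Lemma esum_ind_lt {R : realType} n :
  (\esum_(i in [set: nat]) ind (i < n)%N = n%:R%:E :> \bar R)%E.
Proof.
rewrite -nneseries_esumT; last by move=> i; exact: ind_ge0.
rewrite (nneseries_split 0 n)//; last by move=> i _; exact: ind_ge0.
rewrite add0n eseries0 ?adde0; last by move=> i ni _; rewrite ltnNge ni.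
rewrite big_mkord (eq_bigr (fun=> 1%:E)) => [|i _]; last by rewrite ltn_ord.
by rewrite sumEFin sumr_const card_ord.
Qed.

Section return_times.
Context {disp : measure_display} {T : measurableType disp} {R : realType}.
Variables (P : probability T R) (Z : R -> nat -> T -> R) (x : R).
Variables (H : nat -> R -> set T).
Hypothesis return_timeE :
  forall k w, return_time Z x w = Some k.+1 <-> H k x w.
Hypothesis mH : forall k y, measurable (H k y).
Hypothesis trivH : forall y, trivIset setT (H^~ y).
Local Open Scope ereal_scope.

Let U (k : nat) : set T := ~` \bigcup_(j in `I_k) H j x.

Let mU k : measurable (U k).
Proof. by apply: measurableC; exact: bigcup_measurable. Qed.

Lemma return_time_pos w : return_time Z x w != Some 0%N.
Proof. by apply/eqP => /firstP[[]]. Qed.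

Lemma not_returned k : P (U k) + \sum_(j < k) P (H j x) = 1.
Proof.
have -> : \sum_(j < k) P (H j x) = P (\bigcup_(j in `I_k) H j x).
  rewrite bigcup_mkord (@measure_semi_additive_ord_I _ _ _ P (H^~ x))//.
    by move=> i j _ _; exact: trivH.
  by apply: bigsetU_measurable.
rewrite -measureU//; first by rewrite setvU; exact: probability_setT.
  exact: bigcup_measurable.
by rewrite setICl.
Qed.

(** A time t in {1, 2, ..., oo} is the number of k >= 0 such that t > k. *)
Lemma ext_return_timeE w :
  ext_time (return_time Z x w) = \esum_(k in setT) (\1_(U k) w)%:E :> \bar R.
Proof.
case E : (return_time Z x w) => [n|] /=; last first.
  rewrite -(esum_cst_pinfty (c := 1)) ?lte01//; apply: eq_esum => k _.
  rewrite indicE mem_set//= => -[j _] /return_timeE.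
  by rewrite E.
case: n E => [/eqP|n E]; first by rewrite (negbTE (return_time_pos _)).
rewrite -esum_ind_lt; apply: eq_esum => k _; rewrite indicE ltnS.
have [kn|nk] := leqP k n.
  rewrite mem_set//= => -[j /= jk] /return_timeE.
  by rewrite E => -[nj]; rewrite -nj ltnNge kn in jk.
rewrite memNset//; apply; exists n => //.
exact/return_timeE.
Qed.

Lemma mean_return_timeE :
  mean_return_time P Z x = \esum_(k in setT) P (U k).
Proof.
rewrite /mean_return_time (eq_integral (fun w => \sum_(0 <= k <oo) (\1_(U k) w)%:E)).
  rewrite integral_nneseries//; last first.
    by move=> k; apply/measurable_EFinP; exact: measurable_indic.
  rewrite nneseries_esumT; last by move=> k; apply: integral_ge0 => w _; rewrite lee_fin.
  by apply: eq_esum => k _; rewrite integral_indic// setIT.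
by move=> w _; rewrite ext_return_timeE nneseries_esumT// => k; rewrite lee_fin.
Qed.

Lemma recurrent_stateE : recurrent_state P Z x <-> P (\bigcup_k H k x) = 1.
Proof.
rewrite /recurrent_state; suff -> : [set w | return_time Z x w] = \bigcup_k H k x by [].
apply/seteqP; split=> w /=.
  case E : (return_time Z x w) => [[|k]|]// _; last first.
    by exists k => //; exact/return_timeE.
  by have := return_time_pos w; rewrite E.
by move=> [k _ /return_timeE ->].
Qed.

Lemma recurrent_of_finite_mean : mean_return_time P Z x < +oo -> recurrent_state P Z x.
Proof.
move=> fin; apply/recurrent_stateE.
have mB : measurable (\bigcup_k H k x) by exact: bigcup_measurable.
have : P (~` \bigcup_k H k x) + P (\bigcup_k H k x) = 1.
  rewrite -measureU//; last 2 first.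
  - exact: measurableC.
  - by rewrite setICl.
  by rewrite setvU; exact: probability_setT.
suff -> : P (~` \bigcup_k H k x) = 0 by rewrite add0e.
apply/eqP; rewrite eq_le measure_ge0 andbT leNgt; apply/negP => p0.
move: fin; rewrite mean_return_timeE ltNge => /negP; apply.
rewrite -(esum_cst_pinfty p0); apply: le_esum => k _.
apply: le_measure; rewrite ?inE//; first exact: measurableC.
by apply: subsetC => w [j _ Hj]; exists j.
Qed.

(* H k y is the event that the chain started at y first visits x at time k + 1. *)
Variables (I : (R -> \bar R) -> \bar R) (K : R -> (R -> \bar R) -> \bar R).
Hypothesis hI : sum_functional I.
Hypothesis invariant : forall f, (forall y, 0 <= f y <= 1) ->
  I (fun y => K y f) = I f.
Hypothesis H0 : forall y, P (H 0%N y) = K y (fun z => ind (z == x)).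
Hypothesis HS : forall k y,
  P (H k.+1 y) = K y (fun z => ind (z != x) * P (H k z)).

Lemma kac_return_time : I (fun z => ind (z == x)) < +oo ->
  I (fun y => P (\bigcup_k H k y)) =
  I (fun z => ind (z == x)) * mean_return_time P Z x.
Proof.
move=> fin; rewrite mean_return_timeE.
rewrite -(kac_formula hI invariant (F := fun k y => P (H k y)))//.
- apply: functional_eq => // y.
  rewrite measure_semi_bigcup// ?nneseries_esumT//.
  exact: bigcup_measurable.
- by move=> k y; rewrite measure_ge0 probability_le1.
- exact: not_returned.
Qed.

Lemma positive_recurrent_state :
  0 < I (fun z => ind (z == x)) -> I (fun=> 1) < +oo ->
  recurrent_state P Z x /\ mean_return_time P Z x < +oo.
Proof.
move=> pos fin; have le1 : I (fun z => ind (z == x)) <= I (fun=> 1).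
  by apply: (functional_le hI) => y; [exact: ind_ge0|exact: ind_le1].
have fin1 := le_lt_trans le1 fin.
suff m : mean_return_time P Z x < +oo by split => //; exact: recurrent_of_finite_mean.
have := kac_return_time fin1.
have : I (fun y => P (\bigcup_k H k y)) <= I (fun=> 1).
  apply: (functional_le hI) => y; first exact: measure_ge0.
  by apply: probability_le1; exact: bigcup_measurable.
move=> /le_lt_trans /(_ fin) + E; rewrite E.
by case: (mean_return_time P Z x) => [r||]//; rewrite ?gt0_muley// ltry.
Qed.

End return_times.

(** * Steps of the walk and the reflection kernel *)

Section steps.
Context {R : realType} (p : nat -> \bar R).
Local Open Scope ereal_scope.
Hypothesis p_ge0 : forall s, 0 <= p s.
Hypothesis p_sum1 : \esum_(s in [set: nat]) p s = 1.

(** [walk_step y], [reflected_step y] and [free_step y] integrate a function of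
the next state of the walk started at y, over all increments, over those that
cause a reflection, and over those that do not. *)
Definition walk_step (y : R) (f : R -> \bar R) : \bar R :=
  \esum_(s in [set: nat]) (p s * f `|y - s%:R|%R).

Definition reflected_step (y : R) (f : R -> \bar R) : \bar R :=
  \esum_(s in [set: nat]) (p s * ind (y <= s%:R)%R * f (s%:R - y)%R).

Definition free_step (y : R) (f : R -> \bar R) : \bar R :=
  \esum_(s in [set: nat]) (p s * ind (s%:R < y)%R * f (y - s%:R)%R).

Lemma p_fin s : p s \is a fin_num.
Proof.
by rewrite ge0_fin_numE// (@le_lt_trans _ _ 1) ?ltry// -p_sum1; exact: le_term_esum.
Qed.

Let pind_ge0 s b : 0 <= p s * ind b. Proof. by rewrite mule_ge0 ?ind_ge0. Qed.

Lemma walk_step_functional y : sum_functional (walk_step y).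
Proof. by apply: functional_weighted => // s; exact: functional_eval. Qed.

Lemma reflected_step_functional y : sum_functional (reflected_step y).
Proof. by apply: functional_weighted => // s; exact: functional_eval. Qed.

Lemma free_step_functional y : sum_functional (free_step y).
Proof. by apply: functional_weighted => // s; exact: functional_eval. Qed.

Hint Resolve walk_step_functional reflected_step_functional
  free_step_functional : core.

Lemma walk_stepE y f : (forall z, 0 <= f z) ->
  walk_step y f = reflected_step y f + free_step y f.
Proof.
move=> f0; rewrite -esumD//; last 2 first.
- by move=> s _; rewrite mule_ge0.
- by move=> s _; rewrite mule_ge0.
apply: eq_esum => s _; case: (leP y s%:R) => ys /=.
  by rewrite mule1 mule0 mul0e adde0 distrC ger0_norm// subr_ge0.
by rewrite mule1 mule0 mul0e add0e ger0_norm// subr_ge0 ltW.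
Qed.

Lemma walk_step1 y : walk_step y (fun=> 1) = 1.
Proof. by rewrite -[RHS]p_sum1; apply: eq_esum => s _; rewrite mule1. Qed.

(** A free step with s >= 1 lowers the state by at least 1, so the values at y are
determined by those at states at most y - 1, up to the term s = 0; its weight
p 0 < 1 makes the remaining scalar equation uniquely solvable. The induction is
on an integer bound for y. *)
Lemma bounded_solution_unique (D : set R) (b F G : R -> \bar R) :
  p 0%N < 1 ->
  (forall y s, D y -> 0 < p s -> (s%:R < y)%R -> D (y - s%:R)%R) ->
  (forall y, 0 <= b y) ->
  (forall y, 0 <= F y <= 1) -> (forall y, 0 <= G y <= 1) ->
  (forall y, D y -> F y = b y + free_step y F) ->
  (forall y, D y -> G y = b y + free_step y G) ->
  forall y, D y -> F y = G y.
Proof.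
move=> p01 Dclosed b0 F01 G01 HF HG.
suff H n y : D y -> (y <= n%:R)%R -> F y = G y.
  move=> y Dy; have [y0|y0] := leP y 0%R; first exact: (H 0%N).
  by apply: (H (Num.bound y)) => //; rewrite ltW// archi_boundP// ltW.
elim: n y => [|n IH] y Dy yn.
  rewrite HF// HG//; congr (_ + _); apply: eq_esum => s _.
  by rewrite ltNge (le_trans yn)//= mule0 !mul0e.
have [y0|y0] := leP y 0%R.
  rewrite HF// HG//; congr (_ + _); apply: eq_esum => s _.
  by rewrite ltNge (le_trans y0)//= mule0 !mul0e.
have F0 z : 0 <= F z by case/andP: (F01 z).
have G0 z : 0 <= G z by case/andP: (G01 z).
pose rest (X : R -> \bar R) := \esum_(s in [set: nat])
  (if s == 0%N then 0 else p s * ind (s%:R < y)%R * X (y - s%:R)%R).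
have split0 X : (forall z, 0 <= X z) ->
    free_step y X = p 0%N * X y + rest X.
  move=> X0; rewrite /free_step (esum_split1 0%N)//; last first.
    by move=> s; rewrite mule_ge0.
  by rewrite subr0 y0/= mule1.
have restE : rest F = rest G.
  apply: eq_esum => s _; case: eqVneq => // s0.
  case: (ltP s%:R y) => sy; last by rewrite /= mule0 !mul0e.
  have [ps0|ps0] := eqVneq (p s) 0; first by rewrite ps0 !mul0e.
  congr (_ * _); apply: IH.
    by apply: Dclosed => //; rewrite lt_def ps0 p_ge0.
  rewrite lerBlDr (le_trans yn)// -natrD ler_nat addnC.
  by rewrite -addn1 addnC leq_add2r lt0n.
have rest0 X : (forall z, 0 <= X z) -> 0 <= rest X.
  by move=> X0; apply: esumT_ge0 => s; case: ifP => // _; rewrite mule_ge0.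
have fin01 (a : \bar R) : 0 <= a <= 1 -> a \is a fin_num.
  by case: a => // /andP[].
have Flt : F y < +oo by rewrite ltey_eq fin01.
have HFy := HF y Dy; rewrite split0// in HFy.
have bfin : b y \is a fin_num.
  rewrite ge0_fin_numE// (le_lt_trans _ Flt)// HFy leeDl//.
  by rewrite adde_ge0 ?mule_ge0 ?rest0.
have rfin : rest F \is a fin_num.
  rewrite ge0_fin_numE ?rest0// (le_lt_trans _ Flt)// HFy addeA leeDr//.
  by rewrite adde_ge0 ?mule_ge0.
have := HFy; have := HG y Dy; rewrite split0// -restE.
move: bfin rfin (fin01 _ (F01 y)) (fin01 _ (G01 y)) p01 (p_fin 0%N).
case: (rest F) => [r| |]//; case: (b y) => [c| |]//; case: (F y) => [u| |]//;
  case: (G y) => [v| |]//; case: (p 0%N) => [q| |]//.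
rewrite -!EFinM -!EFinD lte_fin.
move=> _ _ _ _ q1 _ [e1] [e2]; congr (_%:E).
apply/eqP; rewrite -subr_eq0.
have : ((u - v) * (1 - q) = 0)%R by lra.
move/eqP; rewrite mulf_eq0 => /orP[//|/eqP q1']; exfalso; lra.
Qed.

(** The state after the first reflection, on the event that this reflection is
preceded by exactly i free steps. *)
Fixpoint reflection_after (i : nat) (y : R) (f : R -> \bar R) : \bar R :=
  if i is j.+1 then free_step y (fun z => reflection_after j z f)
  else reflected_step y f.

(** The transition kernel of the process of reflections. *)
Definition reflection_kernel (y : R) (f : R -> \bar R) : \bar R :=
  \esum_(i in [set: nat]) reflection_after i y f.

Lemma reflection_after_functional i y : sum_functional (reflection_after i y).
Proof.
by elim: i y => [|i IH] y //=; exact: (functional_comp (free_step_functional y)).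
Qed.

Hint Resolve reflection_after_functional : core.

Lemma reflection_kernel_functional y : sum_functional (reflection_kernel y).
Proof. exact: functional_series. Qed.

Hint Resolve reflection_kernel_functional : core.

Lemma reflection_kernelE y f : (forall z, 0 <= f z) ->
  reflection_kernel y f =
  reflected_step y f + free_step y (fun z => reflection_kernel z f).
Proof.
move=> f0; have a0 i z : 0 <= reflection_after i z f.
  exact: functional_ge0.
rewrite [LHS]esum_nat_recl//; congr (_ + _).
by rewrite (functional_esum (free_step_functional y)).
Qed.

Lemma step_split1 y : reflected_step y (fun=> 1) + free_step y (fun=> 1) = 1.
Proof. by rewrite -walk_stepE// walk_step1. Qed.

Lemma reflection_partial_le1 n y :
  \sum_(i < n) reflection_after i y (fun=> 1) <= 1.
Proof.
have a0 i z : 0 <= reflection_after i z (fun=> 1) by exact: functional_ge0.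
elim: n y => [|n IH] y; first by rewrite big_ord0.
rewrite big_ord_recl -[leRHS](step_split1 y).
apply: leeD; first exact: lexx.
apply: (@le_trans _ _
  (free_step y (fun z => \sum_(i < n) reflection_after i z (fun=> 1)))).
  by rewrite (functional_sum (f := fun i z => reflection_after i z (fun=> 1)) n
    (free_step_functional y))//.
by apply: functional_le => // z; exact: sume_ge0.
Qed.

Lemma reflection_kernel_le1 y : reflection_kernel y (fun=> 1) <= 1.
Proof.
by apply: esum_nat_le => [i|n]; [exact: functional_ge0|exact: reflection_partial_le1].
Qed.

Lemma reflection_kernel01 f y : (forall z, 0 <= f z <= 1) ->
  0 <= reflection_kernel y f <= 1.
Proof.
move=> f01; have f0 z : 0 <= f z by case/andP: (f01 z).
rewrite (functional_ge0 (reflection_kernel_functional y))//=.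
apply: le_trans (reflection_kernel_le1 y); apply: functional_le => // z.
by case/andP: (f01 z).
Qed.

Hypothesis p0_lt1 : p 0%N < 1.

Lemma reflection_kernel_unique (F f : R -> \bar R) :
  (forall z, 0 <= f z <= 1) -> (forall z, 0 <= F z <= 1) ->
  (forall y, F y = reflected_step y f + free_step y F) ->
  forall y, F y = reflection_kernel y f.
Proof.
move=> f01 F01 FE y; have f0 z : 0 <= f z by case/andP: (f01 z).
apply: (@bounded_solution_unique setT (reflected_step^~ f) F
  (reflection_kernel^~ f)) => //.
- by move=> z; exact: functional_ge0.
- by move=> z; exact: reflection_kernel01.
- by move=> z _; rewrite reflection_kernelE.
Qed.

(** Reflections occur almost surely: the constant 1 solves the first-step
equation. *)
Lemma reflection_kernel1 y : reflection_kernel y (fun=> 1) = 1.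
Proof.
rewrite -(@reflection_kernel_unique (fun=> 1))//.
- by move=> z; rewrite lee01 lexx.
- by move=> z; rewrite lee01 lexx.
- by move=> z; rewrite step_split1.
Qed.

End steps.

(** * Sums over the points k d + x0 and their opposites *)

Section progression_sums.
Context {R : realType} (d : nat) (x0 : R).
Local Open Scope ereal_scope.
Implicit Types f g : R -> \bar R.

Definition progression (k : int) : R := (k%:~R * d%:R + x0)%R.

Definition progression_sum (f : R -> \bar R) : \bar R :=
  \esum_(k in [set: int]) f (progression k).

Lemma progression_sum_functional : sum_functional progression_sum.
Proof. by apply: functional_series => k; exact: functional_eval. Qed.

(** Translations by multiples of d permute the progression. *)
Lemma progression_sum_shift (j : int) f :
  progression_sum (fun z => f (z + j%:~R * d%:R)%R) = progression_sum f.
Proof.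
rewrite /progression_sum [RHS](reindex_esum [set: int] _ (fun k => k + j)%R).
  apply: eq_esum => k _; congr f.
  by rewrite /progression rmorphD/=; ring.
split=> //; first by move=> k l _ _; exact: addIr.
by move=> k _; exists (k - j)%R => //; rewrite subrK.
Qed.

Hypothesis d_gt0 : (0 < d)%N.

(** Consecutive points of the progression are at distance d >= 1. *)
Lemma progression_sum_short (A : R -> bool) :
  (forall z z', A z -> A z' -> (`|z - z'| < 1)%R) ->
  progression_sum (fun z => ind (A z)) <= 1.
Proof.
move=> short; have [[k0 Ak0]|none] := pselect (exists k, A (progression k)).
  rewrite /progression_sum (esum_single (i := k0)) ?ind_le1 ?ind_ge0// => k kk0.
  case Ak : (A (progression k)) => //; exfalso.
  have := short _ _ Ak Ak0; rewrite ltNge => /negP; apply.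
  have -> : (progression k - progression k0 = (k - k0)%:~R * d%:R :> R)%R.
    by rewrite /progression rmorphB/=; ring.
  rewrite normrM normr_nat -intr_norm -[leLHS]mulr1 ler_pM//.
    by rewrite ler1z -gtz0_ge1 normr_gt0 subr_eq0.
  by rewrite ler1n.
rewrite /progression_sum esum1 ?lee01// => k _.
by case Ak : (A (progression k)) => //; case: none; exists k.
Qed.

Lemma progression_meets_period (j : nat) :
  exists k, ((j * d)%:R <= progression k < (j.+1 * d)%:R)%R.
Proof.
exists (j%:Z - Num.floor (x0 / d%:R))%R.
have d0 : (0 < d%:R :> R)%R by rewrite ltr0n.
have /andP[lo hi] := floor_itv (x0 / d%:R).
move: lo hi; rewrite ler_pdivlMr// ltr_pdivrMr//.
rewrite /progression rmorphB/= rmorphD/= !natrM -addn1 natrD.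
have -> : (j%:~R = j%:R :> R)%R by [].
by move=> lo hi; apply/andP; split; lra.
Qed.

Lemma progression_sum_period (j : nat) :
  1 <= progression_sum (fun z =>
    ind ((j * d)%:R <= z < (j.+1 * d)%:R)%R).
Proof.
have [k kj] := progression_meets_period j.
apply: le_trans (le_term_esum k _); last by move=> i; exact: ind_ge0.
by rewrite kj.
Qed.

Lemma progression_sum_count (m : nat) (s : bool) :
  progression_sum (fun z => ind (0 <= (if s then z else - z) < m%:R)%R)
  <= m%:R%:E.
Proof.
elim: m => [|m IH].
  rewrite /progression_sum esum1// => k _.
  set y := (if s then _ else _); suff -> : (0 <= y < 0)%R = false by [].
  by apply/negP => /andP[/le_lt_trans h /h]; rewrite ltxx.
rewrite (@functional_eq _ _ _ _ (fun z =>
    ind (0 <= (if s then z else - z) < m%:R)%R +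
    ind (m%:R <= (if s then z else - z) < m.+1%:R)%R) progression_sum_functional).
- rewrite (functionalD progression_sum_functional); last 2 first.
  + by move=> z; exact: ind_ge0.
  + by move=> z; exact: ind_ge0.
  rewrite -(addn1 m) natrD EFinD; apply: leeD => //.
  apply: progression_sum_short => z z'.
  by case: s {IH} => /andP[a b] /andP[a' b']; rewrite ltr_norml; apply/andP; split; lra.
- by move=> z; exact: ind_ge0.
- move=> z; set y := (if s then _ else _).
  rewrite -(addn1 m) natrD.
  have m0 : (0 <= m%:R :> R)%R by [].
  case: (leP 0%R y); case: (ltP y m%:R) => //=; rewrite ?adde0 ?add0e//.
  + by move=> y1 _; have -> : (y < m%:R + 1)%R by clear IH; lra.
  + by move=> *; exfalso; clear IH; lra.
Qed.

Lemma progression_sum_period_count (j : nat) :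
  j%:R%:E <= progression_sum (fun z => ind (0 <= z < (j * d)%:R)%R).
Proof.
elim: j => [|j IH].
  by apply: (functional_ge0 progression_sum_functional) => z; exact: ind_ge0.
have step (z : R) : ind (0 <= z < (j * d)%:R)%R +
    ind ((j * d)%:R <= z < (j.+1 * d)%:R)%R <= ind (0 <= z < (j.+1 * d)%:R)%R :> \bar R.
  have m0 : (0 <= (j * d)%:R :> R)%R by [].
  have mS : ((j * d)%:R <= (j.+1 * d)%:R :> R)%R by rewrite ler_nat leq_mul2r leqnSn orbT.
  case: (leP 0%R z); case: (ltP z (j * d)%:R) => //=; rewrite ?adde0 ?add0e//.
  - by move=> z1 _; have -> : (z < (j.+1 * d)%:R)%R by exact: lt_le_trans mS.
  - by move=> *; exfalso; clear IH; lra.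
apply: le_trans (functional_le progression_sum_functional _ step); last first.
  by move=> z; rewrite adde_ge0 ?ind_ge0.
rewrite (functionalD progression_sum_functional); last 2 first.
- by move=> z; exact: ind_ge0.
- by move=> z; exact: ind_ge0.
have -> : j.+1%:R%:E = j%:R%:E + 1 :> \bar R by rewrite -addn1 natrD EFinD.
exact: leeD IH (progression_sum_period j).
Qed.

(** A point that lies in both progressions is counted twice. This keeps the sum
even and invariant under multiples of d for all x0, without any case
distinction. *)
Definition symmetric_sum (f : R -> \bar R) : \bar R :=
  progression_sum f + progression_sum (fun z => f (- z)%R).

Lemma symmetric_sum_functional : sum_functional symmetric_sum.
Proof.
apply: functional_add; first exact: progression_sum_functional.
apply: (functional_comp (K := fun z f => f (- z)%R)).
  exact: progression_sum_functional.
by move=> z; exact: functional_eval.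
Qed.

Lemma symmetric_sumN f : symmetric_sum (fun z => f (- z)%R) = symmetric_sum f.
Proof.
rewrite /symmetric_sum addeC; congr (_ + _).
by congr progression_sum; apply/funext => z; rewrite opprK.
Qed.

Lemma symmetric_sum_shift (s : nat) f : (d %| s)%N ->
  symmetric_sum (fun z => f (z + s%:R)%R) = symmetric_sum f.
Proof.
move=> /dvdnP[j ->]; rewrite /symmetric_sum; congr (_ + _).
  rewrite -[RHS](progression_sum_shift j%:Z).
  by apply: eq_esum => k _; rewrite natrM.
rewrite -[RHS](progression_sum_shift (- j%:Z)).
apply: eq_esum => k _; rewrite natrM rmorphN/=; congr f.
have -> : (j%:~R = j%:R :> R)%R by [].
by ring.
Qed.

Lemma symmetric_sum_count (m : nat) :
  symmetric_sum (fun z => ind (0 <= z < m%:R)%R) <= (m.*2)%:R%:E.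
Proof.
rewrite -addnn natrD EFinD; apply: leeD.
  exact: (progression_sum_count m true).
exact: (progression_sum_count m false).
Qed.

Lemma symmetric_sum_short (A : R -> bool) :
  (forall z z', A z -> A z' -> (`|z - z'| < 1)%R) ->
  symmetric_sum (fun z => ind (A z)) <= 2%:R%:E.
Proof.
move=> short; rewrite (_ : 2%:R = 1 + 1)%R// EFinD.
apply: leeD; apply: progression_sum_short => // z z' Az Az'.
by rewrite distrC; have := short _ _ Az Az'; rewrite opprK addrC.
Qed.

Definition symmetric_point (z : R) :=
  exists k, z = progression k \/ z = (- progression k)%R.

Lemma symmetric_sum_eq_on f g : (forall z, 0 <= f z) ->
  (forall z, symmetric_point z -> f z = g z) ->
  symmetric_sum f = symmetric_sum g.
Proof.
move=> f0 fg; rewrite /symmetric_sum; congr (_ + _); apply: eq_esum => k _.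
  by apply: fg; exists k; left.
by apply: fg; exists k; right.
Qed.

Lemma le_symmetric_sum f z : (forall z, 0 <= f z) -> symmetric_point z ->
  f z <= symmetric_sum f.
Proof.
move=> f0 [k [->|->]].
  apply: le_trans (leeDl _ _); last exact: esumT_ge0.
  exact: (le_term_esum (a := fun k => f (progression k))).
apply: le_trans (leeDr _ _); last exact: esumT_ge0.
exact: (le_term_esum (a := fun k => f (- progression k)%R)).
Qed.

End progression_sums.

(** * An invariant measure of the walk *)

Section stationary_measure.
Context {R : realType} (p : nat -> \bar R) (d : nat) (x0 : R).
Local Open Scope ereal_scope.
Hypothesis p_ge0 : forall s, 0 <= p s.
Hypothesis p_sum1 : \esum_(s in [set: nat]) p s = 1.
Hypothesis d_gt0 : (0 < d)%N.
Hypothesis p_dvd : forall s, 0 < p s -> (d %| s)%N.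
Implicit Types f g : R -> \bar R.

Let SS := symmetric_sum d x0.
Let hSS : sum_functional SS := symmetric_sum_functional d x0.

(** If a is, up to antisymmetric terms, b(s) + b(t) over 2, then the independent
average of a is the average of b. *)
Lemma symmetrize_double_sum (a : nat -> nat -> \bar R) (b : nat -> \bar R) :
  (forall s t, 0 <= a s t) -> (forall t, 0 <= b t) ->
  (forall s t, 0 < p s -> 0 < p t -> a s t + a t s = b s + b t) ->
  \esum_(t in [set: nat]) \esum_(s in [set: nat]) (p t * p s * a s t) =
  \esum_(t in [set: nat]) (p t * b t).
Proof.
move=> a0 b0 ab.
have ppa0 i j k l : 0 <= p i * p j * a k l by rewrite !mule_ge0.
have ppb0 i j k : 0 <= p i * p j * b k by rewrite !mule_ge0.
have half (u v : \bar R) : 0 <= u -> 0 <= v -> u + u = v + v -> u = v.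
  case: u v => [u||] [v||]//; rewrite ?lee_fin => _ _ // [e].
  by congr EFin; lra.
have swap : \esum_(t in [set: nat]) \esum_(s in [set: nat]) (p t * p s * a s t) =
    \esum_(t in [set: nat]) \esum_(s in [set: nat]) (p t * p s * a t s).
  rewrite exchange_esum; last by move=> i j; exact: ppa0.
  by apply: eq_esum => t _; apply: eq_esum => s _; rewrite (muleC (p t)).
have bE : \esum_(t in [set: nat]) \esum_(s in [set: nat]) (p t * p s * b t) =
    \esum_(t in [set: nat]) (p t * b t).
  apply: eq_esum => t _.
  have -> : \esum_(s in [set: nat]) (p t * p s * b t) =
    \esum_(s in [set: nat]) (p s * (p t * b t)).
    by apply: eq_esum => s _; rewrite muleA (muleC (p s)).
  by rewrite esumZr ?mule_ge0// p_sum1 mul1e.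
have bE' : \esum_(t in [set: nat]) \esum_(s in [set: nat]) (p t * p s * b s) =
    \esum_(t in [set: nat]) (p t * b t).
  rewrite -bE exchange_esum; last by move=> i j; exact: ppb0.
  by apply: eq_esum => t _; apply: eq_esum => s _; rewrite (muleC (p t)).
apply: half.
- by apply: esumT_ge0 => t; exact: esumT_ge0.
- by apply: esumT_ge0 => t; rewrite mule_ge0.
rewrite [X in _ + X = _]swap -[X in _ = X + _]bE' -[X in _ = _ + X]bE.
rewrite -esumD; try by move=> t _; exact: esumT_ge0.
rewrite -[RHS]esumD; try by move=> t _; exact: esumT_ge0.
apply: eq_esum => t _; rewrite -!esumD//.
apply: eq_esum => s _; rewrite -!ge0_muleDr//.
have [ps|ps] := eqVneq (p s) 0; first by rewrite ps mule0 !mul0e.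
have [pt|pt] := eqVneq (p t) 0; first by rewrite pt !mul0e.
by congr (_ * _); apply: ab; rewrite lt_def ?ps ?pt p_ge0.
Qed.

(** Its average over t = Y is P(Y > z) + P(Y >= z) for z > 0, P(Y > 0) for z = 0,
and 0 for z < 0: the density W of the invariant measure. *)
Definition weight (t z : R) : \bar R := ind (0 <= z < t)%R + ind (0 < z <= t)%R.

Lemma weight_ge0 t z : 0 <= weight t z.
Proof. by rewrite adde_ge0 ?ind_ge0. Qed.

Lemma weight_le2 t z : weight t z <= 2%:R%:E * ind (0 <= z <= t)%R.
Proof.
rewrite /weight; case: (ltrgtP z 0%R) => z0; case: (ltrgtP z t) => zt /=;
  rewrite ?adde0 ?mule0 ?mule1 ?add0e ?lee_fin ?ler0n ?ler1n//.
Qed.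

(** Both sides count z in the half-open intervals from -s to t, once with the left
and once with the right end point; they are cut at t - s on the left-hand side
and at 0 on the right-hand side. *)
Lemma weight_exchange (s t z : R) : (0 <= s)%R -> (0 <= t)%R ->
  weight t (z + s) + weight s (- z + t) = weight t z + weight s (- z).
Proof.
move=> s0 t0; rewrite /weight.
have e1 : (0 <= z + s = (- s <= z))%R by rewrite -lerBlDr sub0r.
have e2 : (z + s < t = (z < t - s))%R by rewrite -ltrBrDr.
have e3 : (0 < z + s = (- s < z))%R by rewrite -ltrBlDr sub0r.
have e4 : (z + s <= t = (z <= t - s))%R by rewrite -lerBrDr.
have e5 : (0 <= - z + t = (z <= t))%R by rewrite addrC subr_ge0.
have e6 : (- z + t < s = (t - s < z))%R by rewrite addrC ltrBlDl ltrBlDr.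
have e7 : (0 < - z + t = (z < t))%R by rewrite addrC subr_gt0.
have e8 : (- z + t <= s = (t - s <= z))%R by rewrite addrC lerBlDl lerBlDr.
have e9 : (- z < s = (- s < z))%R by rewrite ltrNl.
have e10 : (- z <= s = (- s <= z))%R by rewrite lerNl.
rewrite e1 e2 e3 e4 e5 e6 e7 e8 e9 e10 oppr_ge0 oppr_gt0.
case: (ltrgtP z t) => h1; case: (ltrgtP z (t - s)%R) => h2;
case: (ltrgtP z (- s)%R) => h3; case: (ltrgtP z 0%R) => h4;
rewrite /= ?adde0 ?add0e//; exfalso; lra.
Qed.

Definition stationary f : \bar R :=
  \esum_(t in [set: nat]) (p t * SS (fun z => weight t%:R z * f z)).

Lemma scaled_eval_functional (c : \bar R) (z : R) : 0 <= c ->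
  sum_functional (fun f => c * f z).
Proof.
move=> c0; split=> [f f0|f g f0 fg|f g f0 g0|e f e0 f0|f f0].
- by rewrite mule_ge0.
- by rewrite lee_wpmul2l.
- by rewrite ge0_muleDr.
- by rewrite muleCA.
- by rewrite esumZl.
Qed.

Lemma weighted_sum_functional (t : R) :
  sum_functional (fun f => SS (fun z => weight t z * f z)).
Proof.
apply: (functional_comp (K := fun z f => weight t z * f z)) => // z.
by apply: scaled_eval_functional; exact: weight_ge0.
Qed.

Lemma stationary_functional : sum_functional stationary.
Proof. by apply: functional_weighted => // t; exact: weighted_sum_functional. Qed.

Let phi f (s t : nat) := SS (fun z => weight t%:R z * f `|z - s%:R|%R).
Let psi f (t : nat) := SS (fun z => weight t%:R z * f z).

Let psi_abs f t : (forall z, 0 <= f z) ->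
  psi f t = SS (fun z => weight t%:R z * f `|z|%R).
Proof.
move=> f0; apply: functional_eq => // z; first by rewrite mule_ge0 ?weight_ge0.
have [z0|z0] := leP 0%R z; first by rewrite ger0_norm.
have z1 : (0 <= z)%R = false by rewrite leNgt z0.
have z2 : (0 < z)%R = false by rewrite ltNge ltW.
by rewrite /weight z1 z2 adde0 !mul0e.
Qed.

(** Translating by s, resp. by t followed by a change of sign, turns the two
left-hand sums into weighted sums of the even function z |-> f `|z| , to which
[weight_exchange] applies. *)
Lemma exchange_steps f s t : (forall z, 0 <= f z) -> (d %| s)%N -> (d %| t)%N ->
  phi f s t + phi f t s = psi f s + psi f t.
Proof.
move=> f0 ds dt.
have wf0 (a b c : R) : 0 <= weight a b * f c by rewrite mule_ge0 ?weight_ge0.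
have -> : phi f s t = SS (fun z => weight t%:R (z + s%:R) * f `|z|%R).
  rewrite /phi /SS -[LHS](symmetric_sum_shift _ _ ds).
  by congr symmetric_sum; apply/funext => z; rewrite addrK.
have -> : phi f t s = SS (fun z => weight s%:R (- z + t%:R) * f `|z|%R).
  rewrite /phi /SS -[LHS](symmetric_sum_shift _ _ dt) -[LHS]symmetric_sumN.
  by congr symmetric_sum; apply/funext => z; rewrite addrK normrN.
have -> : psi f s = SS (fun z => weight s%:R (- z) * f `|z|%R).
  rewrite psi_abs// /SS -[LHS]symmetric_sumN.
  by congr symmetric_sum; apply/funext => z; rewrite normrN.
rewrite psi_abs// -(functionalD hSS)// -[RHS](functionalD hSS)//.
apply: functional_eq => // z; first by rewrite adde_ge0.
by rewrite -!ge0_muleDl ?weight_ge0// weight_exchange// addeC.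
Qed.

(** The independent pair is (s, t), with s the increment and t the variable that
defines the density; the increments are multiples of d, so that
[exchange_steps] applies to all pairs of positive weight. *)
Lemma stationary_walk f : (forall z, 0 <= f z) ->
  stationary (fun y => walk_step p y f) = stationary f.
Proof.
move=> f0.
have wf0 (a b c : R) : 0 <= weight a b * f c by rewrite mule_ge0 ?weight_ge0.
have phi0 s t : 0 <= phi f s t by apply: (functional_ge0 hSS) => z.
have psi0 t : 0 <= psi f t by apply: (functional_ge0 hSS) => z.
have pp0 s t : 0 <= p s * p t by rewrite mule_ge0.
have phiE : stationary (fun y => walk_step p y f) =
    \esum_(t in [set: nat]) \esum_(s in [set: nat]) (p t * p s * phi f s t).
  apply: eq_esum => t _.
  under [RHS]eq_esum do rewrite -muleA.
  rewrite esumZl//; last by move=> s; rewrite mule_ge0.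
  congr (_ * _).
  have h := weighted_sum_functional t%:R.
  have -> : \esum_(s in [set: nat]) (p s * phi f s t) =
     \esum_(s in [set: nat])
       SS (fun z => weight t%:R z * (p s * f `|z - s%:R|%R)).
    apply: eq_esum => s _; rewrite -(functionalZ hSS)//.
    apply: functional_eq => // z; first by rewrite mule_ge0.
    by rewrite muleCA.
  by rewrite -(functional_esum h)// => n z; rewrite mule_ge0.
rewrite phiE; apply: symmetrize_double_sum => // s t ps pt.
by apply: exchange_steps => //; exact: p_dvd.
Qed.

(** The states of the class C(x0), see [C_setE]. *)
Definition in_range (z : R) := [/\ symmetric_point d x0 z, (0 <= z)%R &
  exists t, 0 < p t /\ (z <= t%:R)%R].

Lemma stationary_eq_on f g : (forall z, 0 <= f z) ->
  (forall z, in_range z -> f z = g z) -> stationary f = stationary g.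
Proof.
move=> f0 fg; apply: eq_esum => t _.
have [pt|pt] := eqVneq (p t) 0; first by rewrite pt !mul0e.
congr (_ * _); apply: symmetric_sum_eq_on => z; first by rewrite mule_ge0 ?weight_ge0.
move=> zp; have [/andP[z0 zt]|nz] := boolP (0 <= z <= t%:R)%R.
  rewrite fg//; split => //; exists t; split => //.
  by rewrite lt_def pt p_ge0.
suff -> : weight t%:R z = 0 by rewrite !mul0e.
apply/eqP; rewrite eq_le weight_ge0 andbT.
by apply: le_trans (weight_le2 _ _) _; rewrite (negbTE nz) mule0.
Qed.

Lemma stationary_gt0 f z (t : nat) : (forall z, 0 <= f z) ->
  symmetric_point d x0 z -> (0 <= z <= t%:R)%R -> (0 < t)%N -> 0 < p t ->
  0 < f z -> 0 < stationary f.
Proof.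
move=> f0 zp /andP[z0 zt] t0 pt fz.
have S0 (s : nat) : 0 <= SS (fun z => weight s%:R z * f z).
  exact: (functional_ge0 (weighted_sum_functional _)).
apply: lt_le_trans (le_term_esum t _); last by move=> s; rewrite mule_ge0.
rewrite mule_gt0//.
apply: lt_le_trans (le_symmetric_sum _ zp); last first.
  by move=> y; rewrite mule_ge0 ?weight_ge0.
rewrite mule_gt0//.
rewrite /weight; have [z00|z00] := eqVneq z 0%R.
  by rewrite z00 lexx ltr0n t0/= (lt_le_trans _ (leeDl _ (ind_ge0 _)))// lte_fin.
have zpos : (0 < z)%R by rewrite lt_def z00.
by rewrite (lt_le_trans _ (leeDr _ (ind_ge0 _)))// zpos zt lte_fin.
Qed.

Lemma stationary_point_fin x : stationary (fun z => ind (z == x)) < +oo.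
Proof.
apply: (@le_lt_trans _ _ 4%:R%:E); last exact: ltry.
rewrite -[leRHS]mul1e -p_sum1 -esumZr//.
apply: le_esum => t _; apply: lee_wpmul2l => //.
have -> : 4%:R%:E = 2%:R%:E * 2%:R%:E :> \bar R by rewrite -EFinM -natrM.
apply: le_trans (lee_wpmul2l _ (symmetric_sum_short x0 d_gt0 (A := fun z => z == x) _)).
- rewrite -(functionalZ hSS)//; last by move=> z; exact: ind_ge0.
  apply: (functional_le hSS) => z; first by rewrite mule_ge0 ?weight_ge0 ?ind_ge0.
  apply: lee_wpmul2r; first exact: ind_ge0.
  apply: le_trans (weight_le2 _ _) _; rewrite -[leRHS]mule1.
  by rewrite lee_wpmul2l ?ind_le1.
- by rewrite lee_fin.
- by move=> z z' /eqP-> /eqP->; rewrite subrr normr0.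
Qed.

Lemma weighted_interval_le f t (m : nat) : (forall z, 0 <= f z) ->
  (forall z, weight t z * f z <= 2%:R%:E * ind (0 <= z <= m%:R)%R) ->
  SS (fun z => weight t z * f z) <= (m.+1 * 4)%:R%:E.
Proof.
move=> f0 wf.
have -> : (m.+1 * 4)%:R%:E = 2%:R%:E * (m.+1).*2%:R%:E :> \bar R.
  by rewrite -EFinM -natrM; congr (_%:R%:E); lia.
apply: le_trans (lee_wpmul2l _ (symmetric_sum_count x0 d_gt0 m.+1)); last first.
  by rewrite lee_fin.
rewrite -(functionalZ hSS)//; last by move=> z; exact: ind_ge0.
apply: (functional_le hSS) => z; first by rewrite mule_ge0 ?weight_ge0.
apply: le_trans (wf z) _; apply: lee_wpmul2l => //.
have [/andP[-> zt]|] := boolP (0 <= z <= m%:R)%R; last by rewrite ind_ge0.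
by rewrite (le_lt_trans zt)// ltr_nat.
Qed.

Lemma weighted_count_le (t : nat) :
  SS (fun z => weight t%:R z * 1) <= (t.+1 * 4)%:R%:E.
Proof.
by apply: weighted_interval_le => // z; rewrite mule1; exact: weight_le2.
Qed.

Lemma stationary_mass_le :
  stationary (fun=> 1) <=
  \esum_(t in [set: nat]) (p t * (t.+1 * 4)%:R%:E).
Proof.
apply: le_esum => t _; apply: lee_wpmul2l => //.
exact: weighted_count_le.
Qed.

(** An interval of length t, a multiple of d, contains t / d points of the
progression. *)
Lemma stationary_mass_ge :
  \esum_(t in [set: nat]) (p t * (t %/ d)%:R%:E) <= stationary (fun=> 1).
Proof.
apply: le_esum => t _; have [pt|pt] := eqVneq (p t) 0; first by rewrite pt !mul0e.
apply: lee_wpmul2l => //.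
have dt : (d %| t)%N by apply: p_dvd; rewrite lt_def pt p_ge0.
apply: le_trans (progression_sum_period_count x0 d_gt0 _) _; rewrite divnK//.
apply: (@le_trans _ _ (progression_sum d x0 (fun z => weight t%:R z * 1))).
  apply: (functional_le (progression_sum_functional _ _)) => z; first exact: ind_ge0.
  by rewrite mule1 leeDl// ind_ge0.
by rewrite leeDl//; apply: esumT_ge0 => k; rewrite mule_ge0 ?weight_ge0.
Qed.

End stationary_measure.

(** * An invariant measure of the process of reflections *)

Section reflected_measure.
Context {R : realType} (p : nat -> \bar R) (d : nat) (x0 : R).
Local Open Scope ereal_scope.
Hypothesis p_ge0 : forall s, 0 <= p s.
Hypothesis p_sum1 : \esum_(s in [set: nat]) p s = 1.
Hypothesis d_gt0 : (0 < d)%N.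
Hypothesis p_dvd : forall s, 0 < p s -> (d %| s)%N.
Implicit Types f g : R -> \bar R.

Let nu := stationary p d x0.
Let hnu : sum_functional nu := stationary_functional d x0 p_ge0.
Let hrefl y : sum_functional (reflected_step p y) :=
  reflected_step_functional p_ge0 y.
Let hfree y : sum_functional (free_step p y) := free_step_functional p_ge0 y.
Let hafter i y : sum_functional (reflection_after p i y) :=
  reflection_after_functional p_ge0 i y.

(** The flow of the invariant measure of the walk through reflected steps. *)
Definition reflected_stationary f := stationary p d x0 (fun y => reflected_step p y f).

Let rho := reflected_stationary.

Lemma reflected_stationary_functional : sum_functional reflected_stationary.
Proof. exact: functional_comp hnu hrefl. Qed.

Let hrho : sum_functional rho := reflected_stationary_functional.

Definition law_tail (k : nat) : \bar R := \esum_(s in [set: nat]) (p s * ind (k < s)%N).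

Lemma law_tail_ge0 k : 0 <= law_tail k.
Proof. by apply: esumT_ge0 => s; rewrite mule_ge0 ?ind_ge0. Qed.

(** The points from 0 to min(s, t), each with weight at most 2, in two
progressions with at most one point per unit interval. *)
Lemma weighted_min_le (t s : nat) :
  symmetric_sum d x0 (fun z => weight t%:R z * ind (z <= s%:R)%R) <=
  ((minn s t).+1 * 4)%:R%:E.
Proof.
apply: weighted_interval_le => // z; first exact: ind_ge0.
case: (leP z s%:R) => [zs|sz]; last by rewrite mule0 mule_ge0 ?ind_ge0 ?lee_fin.
rewrite mule1; apply: le_trans (weight_le2 _ _) _.
apply: lee_wpmul2l => //.
case/boolP: (0 <= z <= t%:R)%R => [/andP[-> zt]|]; last by rewrite ind_ge0.
suff -> : (z <= (minn s t)%:R)%R by [].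
by case: (leqP s t).
Qed.

Lemma esum_ind_minn (s t : nat) : \esum_(k in [set: nat])
  (ind (k < s)%N * ind (k < t)%N) = (minn s t)%:R%:E :> \bar R.
Proof.
rewrite -esum_ind_lt; apply: eq_esum => k _; rewrite leq_min.
by case: (k < s)%N; rewrite ?mul1e ?mul0e.
Qed.

(** The mass is at most 4 E(1 + min(Y, Y')) by [weighted_min_le], and
min(s, t) is the number of k below both s and t. *)
Lemma reflected_mass_le : reflected_stationary (fun=> 1) <=
  4%:R%:E + 4%:R%:E * \esum_(k in [set: nat]) (law_tail k * law_tail k).
Proof.
have four0 : 0 <= 4%:R%:E :> \bar R by rewrite lee_fin.
have four : 4%:R%:E = \esum_(s in [set: nat]) (p s * 4%:R%:E) :> \bar R.
  by rewrite esumZr// p_sum1 mul1e.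
have ii0 k (s t : nat) : 0 <= ind (k < s)%N * ind (k < t)%N :> \bar R.
  by rewrite mule_ge0 ?ind_ge0.
have pind0 s b : 0 <= p s * ind b by rewrite mule_ge0 ?ind_ge0.
have tailE : \esum_(k in [set: nat]) (law_tail k * law_tail k) =
   \esum_(t in [set: nat]) (p t * \esum_(s in [set: nat])
      (p s * \esum_(k in [set: nat]) (ind (k < s)%N * ind (k < t)%N))).
  transitivity (\esum_(k in [set: nat]) \esum_(t in [set: nat])
      (p t * ind (k < t)%N * law_tail k)).
    by apply: eq_esum => k _; rewrite esumZr// law_tail_ge0.
  rewrite exchange_esum; last by move=> k t; rewrite mule_ge0 ?law_tail_ge0.
  apply: eq_esum => t _; rewrite -esumZl//; last first.
    by move=> s; rewrite mule_ge0//; exact: esumT_ge0.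
  transitivity (\esum_(k in [set: nat]) \esum_(s in [set: nat])
      (p t * (p s * (ind (k < s)%N * ind (k < t)%N)))).
    apply: eq_esum => k _; rewrite -esumZl//.
    apply: eq_esum => s _; rewrite -!muleA; congr (_ * _).
    by rewrite muleCA; congr (_ * _); rewrite muleC.
  rewrite exchange_esum; last by move=> k s; rewrite !mule_ge0 ?ind_ge0.
  apply: eq_esum => s _; rewrite -[in RHS]esumZl// -esumZl// => k.
  by rewrite mule_ge0.
have inner t : symmetric_sum d x0 (fun z => weight t%:R z * reflected_step p z (fun=> 1))
    <= 4%:R%:E + 4%:R%:E * \esum_(s in [set: nat])
      (p s * \esum_(k in [set: nat]) (ind (k < s)%N * ind (k < t)%N)).
  have hW := weighted_sum_functional d x0 t%:R.
  rewrite (functional_esum hW); last by move=> s z; rewrite mule_ge0.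
  rewrite [X in _ <= X + _]four -[X in _ <= _ + X]esumZl//; last first.
    by move=> s; rewrite mule_ge0//; exact: esumT_ge0.
  rewrite -esumD; last 2 first.
  - by move=> s _; rewrite mule_ge0.
  - by move=> s _; rewrite !mule_ge0//; exact: esumT_ge0.
  apply: le_esum => s _; rewrite esum_ind_minn.
  have -> : p s * 4%:R%:E + 4%:R%:E * (p s * (minn s t)%:R%:E) =
      p s * ((minn s t).+1 * 4)%:R%:E.
    rewrite [4%:R%:E * (p s * _)]muleCA -ge0_muleDr ?mule_ge0 ?lee_fin//.
    by congr (_ * _); rewrite -EFinM -EFinD -natrM -natrD; congr (_%:R%:E); lia.
  apply: le_trans (lee_wpmul2l (p_ge0 s) (weighted_min_le t s)).
  rewrite -(functionalZ (symmetric_sum_functional d x0))//; last first.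
    by move=> z; rewrite mule_ge0 ?weight_ge0 ?ind_ge0.
  apply: (functional_le (symmetric_sum_functional d x0)) => z.
    by rewrite !mule_ge0 ?weight_ge0 ?ind_ge0.
  by rewrite mule1 muleCA.
have pmin0 t : 0 <= \esum_(s in [set: nat])
      (p s * \esum_(k in [set: nat]) (ind (k < s)%N * ind (k < t)%N)).
  by apply: esumT_ge0 => s; rewrite mule_ge0//; exact: esumT_ge0.
rewrite tailE [X in _ <= X + _]four -[X in _ <= _ + X]esumZl//; last first.
  by move=> t; rewrite mule_ge0.
rewrite -esumD; last 2 first.
- by move=> t _; rewrite mule_ge0.
- by move=> t _; rewrite !mule_ge0.
apply: le_esum => t _.
rewrite [4%:R%:E * (p t * _)]muleCA -ge0_muleDr ?mule_ge0//.
exact: lee_wpmul2l.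
Qed.

Hypothesis p0_lt1 : p 0%N < 1.
Hypothesis fin_mass : reflected_stationary (fun=> 1) < +oo.

Let partial n f y := \sum_(i < n) reflection_after p i y f.

Let partial_ge0 n f y : (forall z, 0 <= f z) -> 0 <= partial n f y.
Proof. by move=> f0; apply: sume_ge0 => i _; exact: functional_ge0. Qed.

Let partialS n f y : (forall z, 0 <= f z) ->
  partial n.+1 f y = reflected_step p y f + free_step p y (partial n f).
Proof.
move=> f0; rewrite /partial big_ord_recl; congr (_ + _).
rewrite (functional_sum (f := fun i z => reflection_after p i z f) n (hfree y))//.
by move=> i z; exact: functional_ge0.
Qed.

Let nu_step f : (forall z, 0 <= f z) ->
  rho f + nu (fun y => free_step p y f) = nu f.
Proof.
move=> f0; have r0 y := functional_ge0 (hrefl y) f0.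
have h0 y := functional_ge0 (hfree y) f0.
rewrite -[RHS](stationary_walk x0 p_ge0 p_sum1 p_dvd)// -(functionalD hnu)//.
apply: functional_eq => // y; first by rewrite adde_ge0.
by rewrite walk_stepE.
Qed.

Let nu_partialS n f : (forall z, 0 <= f z) ->
  nu (partial n.+1 f) = rho f + nu (fun y => free_step p y (partial n f)).
Proof.
move=> f0; have r0 y := functional_ge0 (hrefl y) f0.
have h0 y := functional_ge0 (hfree y) (fun z => partial_ge0 n z f0).
rewrite -(functionalD hnu)//; apply: functional_eq => // y.
  exact: partial_ge0.
exact: partialS.
Qed.

Let free_le f : (forall z, 0 <= f z) -> nu (fun y => free_step p y f) <= nu f.
Proof.
by move=> f0; rewrite -[leRHS]nu_step// leeDr//; exact: functional_ge0.
Qed.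

Let nu_partial_fin n f : (forall z, 0 <= f z) -> rho f < +oo ->
  nu (partial n f) < +oo.
Proof.
move=> f0 fin; elim: n => [|n IH].
  rewrite (@functional_eq _ _ _ _ (fun=> 0) hnu).
  - by rewrite (functional0 hnu) ltry.
  - by move=> z; exact: partial_ge0.
  - by move=> z; rewrite /partial big_ord0.
rewrite (nu_partialS n f0); apply: (lte_add_pinfty fin).
by apply: le_lt_trans IH; apply: free_le => z; exact: partial_ge0.
Qed.

(** Let q_n be the sum of the first n terms of the kernel applied to f. Then
q_{n+1} is a reflected step of f plus a free step of q_n, while nu(q_n) is
rho(q_n) plus the measure nu of a free step of q_n. Since q_n <= q_{n+1} and
nu(q_n) is finite, the free parts cancel and rho(q_n) <= rho(f). The truncation
is needed because nu may be infinite. *)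
Lemma reflected_subinvariant f : (forall z, 0 <= f z) -> rho f < +oo ->
  rho (fun y => reflection_kernel p y f) <= rho f.
Proof.
move=> f0 fin.
have a0 i y : 0 <= reflection_after p i y f by exact: functional_ge0.
rewrite (functional_esum hrho)//; apply: esum_nat_le => [i|n].
  exact: functional_ge0.
have sumE : rho (partial n f) = \sum_(i < n) rho (reflection_after p i ^~ f).
  exact: (functional_sum n hrho a0).
rewrite -sumE; have q0 y := partial_ge0 n y f0.
have h0 y := functional_ge0 (hfree y) q0.
have finq : nu (fun y => free_step p y (partial n f)) \is a fin_num.
  rewrite ge0_fin_numE; last exact: (functional_ge0 hnu).
  by apply: le_lt_trans (nu_partial_fin n f0 fin); exact: free_le.
have mono : nu (partial n f) <= nu (partial n.+1 f).
  apply: (functional_le hnu q0) => y.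
  by rewrite /partial big_ord_recr/=; exact: leeDl.
rewrite -(nu_step q0) (nu_partialS n f0) in mono.
by rewrite leeD2rE in mono.
Qed.

(** Subinvariance holds for f and for 1 - f, and the two inequalities add up to
an equality because the kernel preserves the constant 1 and rho is finite. *)
Lemma reflected_invariant f : (forall z, 0 <= f z <= 1) ->
  rho (fun y => reflection_kernel p y f) = rho f.
Proof.
move=> f01; have f0 z : 0 <= f z by case/andP: (f01 z).
pose g z := 1 - f z.
have ffin z : f z \is a fin_num.
  by rewrite ge0_fin_numE// (le_lt_trans _ (ltry 1))//; case/andP: (f01 z).
have fg z : f z + g z = 1 by rewrite /g addeC subeK.
have g0 z : 0 <= g z by rewrite /g sube_ge0 ?ffin//; case/andP: (f01 z).
have Q0 h y : (forall z, 0 <= h z) -> 0 <= reflection_kernel p y h.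
  by move=> h0; exact: (functional_ge0 (reflection_kernel_functional p_ge0 y)).
have e1 : rho f + rho g = rho (fun=> 1).
  rewrite -(functionalD hrho f0 g0); apply: (functional_eq hrho) => z.
    by rewrite adde_ge0.
  exact: fg.
have e2 : rho (fun y => reflection_kernel p y f) +
          rho (fun y => reflection_kernel p y g) = rho (fun=> 1).
  rewrite -(functionalD hrho (fun y => Q0 f y f0) (fun y => Q0 g y g0)).
  apply: (functional_eq hrho) => y; first by rewrite adde_ge0 ?Q0.
  rewrite -(functionalD (reflection_kernel_functional p_ge0 y) f0 g0).
  rewrite -[RHS](reflection_kernel1 p_ge0 p_sum1 p0_lt1 y).
  apply: (functional_eq (reflection_kernel_functional p_ge0 y)) => z.
    by rewrite adde_ge0.
  exact: fg.
have rf0 : 0 <= rho f := functional_ge0 hrho f0.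
have rg0 : 0 <= rho g := functional_ge0 hrho g0.
have fin1 : rho (fun=> 1) < +oo := fin_mass.
have ff : rho f < +oo.
  by apply: le_lt_trans (functional_le hrho f0 _) fin1 => z; case/andP: (f01 z).
have gf : rho g < +oo.
  by apply: le_lt_trans (functional_le hrho g0 _) fin1 => z; rewrite -(fg z) leeDr.
have gfin : rho g \is a fin_num by rewrite ge0_fin_numE.
have subf := reflected_subinvariant f0 ff.
have subg := reflected_subinvariant g0 gf.
exact: (eq_of_le_add gfin subf subg (etrans e2 (esym e1))).
Qed.

Lemma reflected_point_gt0 x (s : nat) : symmetric_point d x0 (s%:R - x)%R ->
  (0 <= x <= s%:R)%R -> (0 < s)%N -> 0 < p s ->
  0 < rho (fun z => ind (z == x)).
Proof.
move=> sx /andP[x_ge0 xs] s0 ps.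
apply: (@stationary_gt0 _ p d x0 p_ge0 _ (s%:R - x)%R s) => //.
- by move=> z; apply: (functional_ge0 (hrefl z)) => y; exact: ind_ge0.
- by rewrite subr_ge0 xs lerBlDr lerDl.
have := le_term_esum s (fun j => _ : 0 <= p j * ind (s%:R - x <= j%:R)%R *
   ind (j%:R - (s%:R - x) == x)%R).
move=> /(_ (fun j => mule_ge0 (mule_ge0 (p_ge0 j) (ind_ge0 _)) (ind_ge0 _))).
apply: lt_le_trans.
by rewrite lerBlDr lerDl x_ge0 subKr eqxx !mule1.
Qed.

End reflected_measure.

(** * The Markov property of the increments *)

Section increment_sequences.
Implicit Types (w : nat -> nat) (A : (nat -> nat) -> Prop).

Definition scons (s : nat) (w : nat -> nat) : nat -> nat :=
  fun n => if n is m.+1 then w m else s.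

(** The sequence that follows u before time m, and then runs through w. *)
Definition splice (m : nat) (u w : nat -> nat) : nat -> nat :=
  fun i => if (i < m)%N then u i else w (i - m)%N.

Definition agree (n : nat) w w' := forall i, (i < n)%N -> w i = w' i.

Definition determined (n : nat) A := forall w w', agree n w w' -> A w -> A w'.

(** Open in the product topology: membership is decided by finitely many
increments, in a number that depends on the sequence. *)
Definition open_event A :=
  forall w, A w -> exists n, forall w', agree n w w' -> A w'.

(** The first time at which the increments decide that A holds; this splits an
open event into disjoint events, each determined by finitely many increments. *)
Definition decided_at A (n : nat) w :=
  (forall w', agree n w w' -> A w') /\
  forall m, (m < n)%N -> ~ forall w', agree m w w' -> A w'.

Lemma agree_sym n w w' : agree n w w' -> agree n w' w.
Proof. by move=> h i /h. Qed.

Lemma agree_trans n w1 w2 w3 : agree n w1 w2 -> agree n w2 w3 -> agree n w1 w3.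
Proof. by move=> h1 h2 i i_n; rewrite h1// h2. Qed.

Lemma agree_le m n w w' : (m <= n)%N -> agree n w w' -> agree m w w'.
Proof. by move=> mn h i im; apply: h; exact: leq_trans mn. Qed.

Lemma agree_scons n s w w' : agree n w w' -> agree n.+1 (scons s w) (scons s w').
Proof. by move=> h [|i]//= /h. Qed.

Lemma determined_le m n A : (m <= n)%N -> determined m A -> determined n A.
Proof. by move=> mn h w w' /(agree_le mn); exact: h. Qed.

Lemma determined_scons n s A :
  determined n.+1 A -> determined n (fun w => A (scons s w)).
Proof. by move=> h w w' ww'; apply: h; exact: agree_scons. Qed.

Lemma open_scons s A : open_event A -> open_event (fun w => A (scons s w)).
Proof.
move=> oA w /oA[n h]; exists n => w' ww'.
by apply: h; apply: (agree_le (leqnSn n)); exact: agree_scons.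
Qed.

Lemma determined_open n A : determined n A -> open_event A.
Proof. by move=> h w Aw; exists n => w' /h; exact. Qed.

Lemma decided_at_determined A n : determined n (decided_at A n).
Proof.
move=> w w' ww' [h1 h2]; split=> [w'' w'w''|m mn h].
  by apply: h1; exact: agree_trans w'w''.
apply: (h2 m mn) => w'' ww''; apply: h; apply: agree_trans ww''.
by apply: agree_sym; apply: agree_le ww'; exact: ltnW.
Qed.

Lemma decided_at_inj A m n w : decided_at A m w -> decided_at A n w -> m = n.
Proof.
move=> [m1 m2] [n1 n2].
by case: (ltngtP m n) => [mn|nm|]//; [case: (n2 m mn m1)|case: (m2 n nm n1)].
Qed.

Lemma open_eventE A w : open_event A -> A w <-> exists n, decided_at A n w.
Proof.
move=> oA; split=> [Aw|[n [h _]]]; last by apply: h.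
have ex : exists n, `[< forall w', agree n w w' -> A w' >].
  by have [n h] := oA _ Aw; exists n; apply/asboolP.
case: (ex_minnP ex) => n /asboolP hn nmin; exists n; split=> // m mn hm.
have /nmin : `[< forall w', agree m w w' -> A w' >] by apply/asboolP.
by rewrite leqNgt mn.
Qed.

End increment_sequences.

Section markov_property.
Context {disp : measure_display} {T : measurableType disp} {R : realType}.
Variables (P : probability T R) (Y : nat -> {RV P >-> nat}).
Variable (mu : probability nat R).
Hypothesis hY : iid_with_law Y mu.
Implicit Types A : (nat -> nat) -> Prop.
Local Open Scope ereal_scope.

Definition law (s : nat) : \bar R := mu [set s].

Definition event A : set T := [set x | A (fun n => Y n x)].

Lemma measure_disjoint_union (F : nat -> set T) :
  (forall n, measurable (F n)) -> trivIset setT F ->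
  P (\bigcup_n F n) = \esum_(n in setT) P (F n).
Proof.
move=> mF tF; rewrite measure_semi_bigcup// ?nneseries_esumT//.
exact: bigcup_measurable.
Qed.

Lemma law_ge0 s : 0 <= law s. Proof. exact: measure_ge0. Qed.

Lemma law_esum (A : set nat) : mu A = \esum_(s in setT) (law s * ind (s \in A)).
Proof.
have AE : A = \bigcup_s ([set s] `&` A).
  by apply/seteqP; split=> [s As|s [_ _ [->]]]//; exists s.
rewrite {1}AE measure_semi_bigcup//; last first.
  by move=> i j _ _ [k [[/= -> _] [/= ->]]].
rewrite nneseries_esumT//; apply: eq_esum => s _; rewrite /law.
case: (boolP (s \in A)) => [|] sA; rewrite /= ?mule1 ?mule0.
  by congr (mu _); apply/seteqP; split=> [k []//|k /= ->]; split => //; exact: set_mem.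
suff -> : [set s] `&` A = set0 by rewrite measure0.
by apply/seteqP; split=> // k [/= -> As]; rewrite notin_setE in sA.
Qed.

Lemma law_sum1 : \esum_(s in setT) law s = 1.
Proof.
have <- : mu setT = 1 by exact: probability_setT.
by rewrite law_esum; apply: eq_esum => s _; rewrite in_setT mule1.
Qed.

Lemma measurable_increment (i s : nat) : measurable [set x | Y i x = s].
Proof.
rewrite (_ : [set x | Y i x = s] = Y i @^-1` [set s])//.
by rewrite -[X in measurable X]setTI; exact: measurable_funP.
Qed.

Let cylinder (m : nat) (u : nat -> nat) : set T :=
  [set x | forall i, (i < m)%N -> Y i x = u i].

Let cylinder_bigcap m u :
  cylinder m u = \bigcap_(i in [set` iota 0 m]) (Y i @^-1` [set u i]).
Proof.
apply/seteqP; split=> x /= h i /=; first by rewrite mem_iota => /andP[_]; exact: h.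
by move=> im; apply: (h i) => /=; rewrite mem_iota.
Qed.

Lemma prob_cylinder m u : P (cylinder m u) = \prod_(i < m) law (u i).
Proof.
rewrite cylinder_bigcap (hY.1 (iota 0 m) (fun i => [set u i]) (iota_uniq _ _)).
rewrite -(big_mkord xpredT (fun i => law (u i))) /index_iota subn0.
by apply: eq_bigr => i _; exact: hY.2.
Qed.

(** The probability of an event determined by n increments, as an iterated sum. *)
Fixpoint finite_prob (n : nat) A : \bar R :=
  if n is k.+1 then \esum_(s in setT) (law s * finite_prob k (fun w => A (scons s w)))
  else ind `[< A (fun=> 0%N) >].

Lemma finite_prob_ge0 n A : 0 <= finite_prob n A.
Proof.
elim: n A => [|n IH] A; first exact: ind_ge0.
by apply: esumT_ge0 => s; rewrite mule_ge0 ?law_ge0.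
Qed.

Let upd (m : nat) (u : nat -> nat) (s : nat) i := if i == m then s else u i.

Let splice_upd m u s w : splice m.+1 (upd m u s) w = splice m u (scons s w).
Proof.
apply/funext => i; rewrite /splice /upd ltnS.
case: (ltngtP i m) => [im|mi|->]; rewrite ?subnn//=.
by rewrite -(subnSK mi).
Qed.

Let cylinder_split m u A :
  cylinder m u `&` event A = \bigcup_s (cylinder m.+1 (upd m u s) `&` event A).
Proof.
apply/seteqP; split=> x.
  move=> [cx Ax]; exists (Y m x) => //; split=> // i; rewrite ltnS /upd.
  by case: ltngtP => // [im _|-> //]; exact: cx.
move=> [s _ [cx Ax]]; split=> // i im.
by have := cx i (ltnW im); rewrite /upd (ltn_eqF im).
Qed.

(** Induction on the number n of increments that remain to be summed over, for an
arbitrary prescribed beginning of length m: the increment at time m is split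
into its values. *)
Lemma prob_cylinder_event n m u A : determined (m + n) A ->
  measurable (cylinder m u `&` event A) /\
  P (cylinder m u `&` event A) =
  (\prod_(i < m) law (u i)) * finite_prob n (fun w => A (splice m u w)).
Proof.
elim: n m u => [|n IH] m u dA.
  rewrite addn0 in dA; have eqA x : cylinder m u x ->
      A (fun n => Y n x) <-> A (splice m u (fun=> 0%N)).
    move=> cx; split; apply: dA => i im; rewrite /splice im; first exact: cx.
    by rewrite cx.
  have mc : measurable (cylinder m u).
    rewrite cylinder_bigcap; apply: bigcap_measurableType => i _.
    exact: measurable_increment.
  rewrite /=; case: asboolP => Au.
    have -> : cylinder m u `&` event A = cylinder m u.
      by apply/seteqP; split=> [x []//|x cx]; split => //; exact/(eqA x cx).
    by rewrite mule1 prob_cylinder.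
  have -> : cylinder m u `&` event A = set0.
    by apply/seteqP; split=> [x [cx]|//]; move/(eqA x cx)/Au.
  by rewrite mule0 measure0.
have dS : determined (m.+1 + n) A by rewrite addSnnS.
have IHs s := IH m.+1 (upd m u s) dS.
rewrite cylinder_split; split.
  by apply: bigcup_measurable => s _; exact: (IHs s).1.
rewrite measure_disjoint_union; last 2 first.
- by move=> s; exact: (IHs s).1.
- move=> s t _ _ [x [[cs _] [ct _]]].
  by have := cs m (ltnSn m); rewrite ct// /upd eqxx.
rewrite /= -esumZl; last 2 first.
- by apply: prode_ge0 => i _; exact: law_ge0.
- by move=> s; rewrite mule_ge0 ?law_ge0 ?finite_prob_ge0.
apply: eq_esum => s _; rewrite (IHs s).2 big_ord_recr /= /upd eqxx -muleA.
congr (_ * _); first by apply: eq_bigr => i _; rewrite ltn_eqF.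
congr (_ * finite_prob _ _); apply/funext => w.
by rewrite splice_upd.
Qed.

Lemma measurable_determined n A : determined n A -> measurable (event A).
Proof.
move=> dA; have [] := @prob_cylinder_event n 0 (fun=> 0%N) A dA.
by rewrite (_ : cylinder 0 _ `&` _ = event A)//; apply/seteqP; split=> [x []|x].
Qed.

Lemma prob_determined n A : determined n A -> P (event A) = finite_prob n A.
Proof.
move=> dA; have [_] := @prob_cylinder_event n 0 (fun=> 0%N) A dA.
rewrite (_ : cylinder 0 _ `&` _ = event A); last first.
  by apply/seteqP; split=> [x []|x].
rewrite big_ord0 mul1e => ->; congr finite_prob; apply/funext => w.
by congr A; apply/funext => i; rewrite /splice ltn0 subn0.
Qed.

Lemma markov_determined n A : determined n.+1 A ->
  P (event A) = \esum_(s in setT) (law s * P (event (fun w => A (scons s w)))).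
Proof.
move=> dA; rewrite (prob_determined dA); apply: eq_esum => s _.
by rewrite (prob_determined (@determined_scons n s A dA)).
Qed.

Let event_open A : open_event A ->
  event A = \bigcup_n event (decided_at A n).
Proof.
move=> oA; apply/seteqP; split=> x.
  by move/(open_eventE _ oA) => [n h]; exists n.
by move=> [n _ h]; apply/(open_eventE _ oA); exists n.
Qed.

Lemma measurable_open A : open_event A -> measurable (event A).
Proof.
move=> oA; rewrite event_open//; apply: bigcup_measurable => n _.
exact: measurable_determined (@decided_at_determined A n).
Qed.

(** Conditioning on the first increment: by independence and stationarity the
remaining increments can be replaced by the whole sequence. *)
Lemma markov_property A : open_event A ->
  P (event A) = \esum_(s in setT) (law s * P (event (fun w => A (scons s w)))).
Proof.
move=> oA; have dA n := @decided_at_determined A n.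
have dS n := determined_le (leqnSn n) (dA n).
rewrite event_open// measure_disjoint_union; last 2 first.
- by move=> n; exact: measurable_determined (dA n).
- by move=> m n _ _ [x [hm hn]]; exact: decided_at_inj hm hn.
transitivity (\esum_(n in setT) \esum_(s in setT)
    (law s * P (event (fun w => decided_at A n (scons s w))))).
  by apply: eq_esum => n _; exact: markov_determined (dS n).
rewrite exchange_esum; last by move=> n s; rewrite mule_ge0 ?law_ge0.
apply: eq_esum => s _; rewrite esumZl ?law_ge0//; congr (_ * _).
rewrite -measure_disjoint_union; last 2 first.
- by move=> n; exact: measurable_determined (@determined_scons n s _ (dS n)).
- by move=> m n _ _ [x [hm hn]]; exact: decided_at_inj hm hn.
congr (P _); apply/seteqP; split=> x.
  by move=> [n _ h]; apply/(open_eventE _ oA); exists n.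
by move/(open_eventE _ oA) => [n h]; exists n.
Qed.

End markov_property.

(** * Trajectories and reflection times *)

Section trajectories.
Context {R : realType}.
Implicit Types (x y z : R) (w : nat -> nat).

Fixpoint trajectory x w (n : nat) : R :=
  if n is m.+1 then `|trajectory x w m - (w m)%:R| else x.

Fixpoint reflections x w (n : nat) : nat :=
  if n is m.+1 then (reflections x w m + (trajectory x w m <= (w m)%:R)%R)%N else 0%N.

(** The time of the k-th reflection is the first time at which k reflections have
occurred. *)
Definition first_passage x k w n :=
  reflections x w n = k /\ forall m, (m < n)%N -> (reflections x w m < k)%N.

(** The k-th reflection takes place and leads to z. *)
Definition reflected_at x k w z :=
  exists n, first_passage x k w n /\ trajectory x w n = z.

Definition walk_at x k w z := trajectory x w k = z.

Lemma trajectory_scons x s w n :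
  trajectory x (scons s w) n.+1 = trajectory (`|x - s%:R|)%R w n.
Proof. by elim: n => [|n IH] //=; rewrite -IH. Qed.

Lemma reflections_scons x s w n :
  reflections x (scons s w) n.+1 =
  ((x <= s%:R)%R + reflections (`|x - s%:R|)%R w n)%N.
Proof.
elim: n => [|n IH]; first by rewrite /= addnC.
have step v m : reflections x v m.+1 =
    (reflections x v m + (trajectory x v m <= (v m)%:R)%R)%N by [].
by rewrite step IH trajectory_scons addnA.
Qed.

Lemma trajectory_agree x n w w' : agree n w w' -> trajectory x w n = trajectory x w' n.
Proof.
by elim: n => [|n IH] //= h; rewrite IH ?h//; exact: agree_le (leqnSn n) h.
Qed.

Lemma reflections_agree x n w w' : agree n w w' ->
  reflections x w n = reflections x w' n.
Proof.
elim: n => [|n IH] //= h; have h' := agree_le (leqnSn n) h.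
by rewrite IH// (trajectory_agree _ h') h.
Qed.

Lemma reflections_le x w m n : (m <= n)%N ->
  (reflections x w m <= reflections x w n)%N.
Proof.
by elim: n => [|n IH]; [rewrite leqn0 => /eqP->|
  rewrite leq_eqVlt => /orP[/eqP->//|/IH h]; rewrite (leq_trans h)//= leq_addr].
Qed.

Lemma first_passage_inj x k w m n :
  first_passage x k w m -> first_passage x k w n -> m = n.
Proof.
move=> [m1 m2] [n1 n2]; case: (ltngtP m n) => // [/n2|/m2].
  by rewrite m1 ltnn.
by rewrite n1 ltnn.
Qed.

Lemma first_passage_scons x k s w n :
  first_passage x k.+1 (scons s w) n.+1 <->
  if x <= s%:R then first_passage (s%:R - x) k w n
  else first_passage (x - s%:R) k.+1 w n.
Proof.
rewrite /first_passage; case: (leP x s%:R) => xs.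
  have rS m : reflections x (scons s w) m.+1 = (reflections (s%:R - x) w m).+1.
    by rewrite reflections_scons xs distrC ger0_norm ?subr_ge0.
  rewrite rS; split=> [[[e] h]|[-> h]]; split => // m.
    by move=> mn; have := h m.+1 mn; rewrite rS.
  by case: m => // m mn; rewrite rS; exact: h.
have rS m : reflections x (scons s w) m.+1 = reflections (x - s%:R) w m.
  by rewrite reflections_scons leNgt xs ger0_norm// subr_ge0 ltW.
rewrite rS; split=> [[e h]|[-> h]]; split => // m.
  by move=> mn; have := h m.+1 mn; rewrite rS.
by case: m => // m mn; rewrite rS; exact: h.
Qed.

(** A first step that is a reflection uses up one reflection; a free one only
moves the starting point. *)
Lemma reflected_at_scons x k s w z :
  reflected_at x k.+1 (scons s w) z <->
  if x <= s%:R then reflected_at (s%:R - x) k w z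
  else reflected_at (x - s%:R) k.+1 w z.
Proof.
have H n := first_passage_scons x k s w n.
split.
  move=> [[|n] [f ez]]; first by case: f.
  move: f ez => /H; rewrite trajectory_scons; case: (leP x s%:R) => xs f ez.
    by exists n; split=> //; rewrite -ez distrC ger0_norm ?subr_ge0.
  by exists n; split=> //; rewrite -ez ger0_norm// subr_ge0 ltW.
case: (leP x s%:R) H => xs H [n [f ez]]; exists n.+1; split;
  rewrite ?trajectory_scons; try exact/H.
  by rewrite distrC ger0_norm ?subr_ge0.
by rewrite ger0_norm ?subr_ge0 ?ltW.
Qed.

Lemma reflected_at0 x w z : reflected_at x 0 w z <-> x = z.
Proof.
split=> [[[|n] [[_ h] e]]//|->]; first by have := h 0%N isT.
by exists 0%N.
Qed.

Lemma open_reflected_at x k z : open_event (fun w => reflected_at x k w z).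
Proof.
move=> w [n [[e h] ez]]; exists n => w' ww'; exists n.
rewrite -(trajectory_agree _ ww'); split => //; split.
  by rewrite -(reflections_agree _ ww').
by move=> m mn; rewrite -(reflections_agree x (agree_le (ltnW mn) ww')) h.
Qed.

(** Started at y, the chain is at x at time k + 1 and not at the times 1 to k. *)
Definition hits (at_state : R -> nat -> (nat -> nat) -> R -> Prop) x k y w :=
  at_state y k.+1 w x /\ forall j, (j < k)%N -> ~ at_state y j.+1 w x.

Lemma open_walk_hits x k y : open_event (hits walk_at x k y).
Proof.
move=> w [e h]; exists k.+1 => w' ww'; split.
  by rewrite /walk_at -(trajectory_agree _ ww').
move=> j jk; have ww'' : agree j.+1 w w' by apply: agree_le ww'; lia.
by rewrite /walk_at -(trajectory_agree _ ww''); exact: h.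
Qed.

(** The trajectory up to the reflection k + 1 also contains all the earlier
reflections. *)
Lemma open_reflected_hits x k y : open_event (hits reflected_at x k y).
Proof.
move=> w [[n [[e hn] ez]] h]; exists n => w' ww'; split.
  exists n; rewrite -(trajectory_agree _ ww'); split => //; split.
    by rewrite -(reflections_agree _ ww').
  by move=> m mn; rewrite -(reflections_agree _ (agree_le (ltnW mn) ww')) hn.
move=> j jk [i [[ei hi] zi]]; apply: (h j jk).
have i_n : (i <= n)%N.
  rewrite leqNgt; apply/negP => ni; have := hi n ni.
  by rewrite -(reflections_agree _ ww') e; lia.
have wwi := agree_le i_n ww'.
exists i; rewrite (trajectory_agree _ wwi); split => //; split.
  by rewrite (reflections_agree _ wwi).
by move=> m mi; rewrite (reflections_agree _ (agree_le (ltnW mi) wwi)) hi.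
Qed.

Lemma walk_hits0 x y s w : hits walk_at x 0 y (scons s w) <-> `|y - s%:R| = x.
Proof. by split=> [[]|e]; last split. Qed.

Lemma walk_hitsS x k y s w : hits walk_at x k.+1 y (scons s w) <->
  `|y - s%:R| <> x /\ hits walk_at x k `|y - s%:R| w.
Proof.
rewrite /hits /walk_at trajectory_scons; split.
  move=> [e h]; split; first exact: (h 0%N isT).
  by split=> // j jk; have := h j.+1 jk; rewrite trajectory_scons.
move=> [ne [e h]]; split => // -[|j] jk //.
by rewrite trajectory_scons; exact: h.
Qed.

Lemma reflected_hits0 x y s w : hits reflected_at x 0 y (scons s w) <->
  if y <= s%:R then s%:R - y = x else hits reflected_at x 0 (y - s%:R) w.
Proof.
have e : hits reflected_at x 0 y (scons s w) <-> reflected_at y 1 (scons s w) x.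
  by split=> [[]//|h]; split.
apply: (iff_trans e); apply: (iff_trans (reflected_at_scons _ _ _ _ _)).
case: ifP => _; first exact: reflected_at0.
by split=> [h|[]//]; split.
Qed.

Lemma reflected_hitsS x k y s w : hits reflected_at x k.+1 y (scons s w) <->
  if y <= s%:R then s%:R - y <> x /\ hits reflected_at x k (s%:R - y) w
  else hits reflected_at x k.+1 (y - s%:R) w.
Proof.
have H j := reflected_at_scons y j s w x.
rewrite /hits; case: ifP H => _ H; split.
- move=> [/H e h]; split; first by move=> sx; apply: (h 0%N isT); apply/H/reflected_at0.
  by split => // j jk /H; exact: h.
- move=> [ne [e h]]; split; first exact/H.
  by move=> [|j] jk /H; [move/reflected_at0|exact: h].
- move=> [/H e h]; split => // j jk /H; exact: h.
- by move=> [e h]; split; [exact/H|move=> j jk /H; exact: h].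
Qed.

End trajectories.

Section processes_as_trajectories.
Context {disp : measure_display} {T : measurableType disp} {R : realType}.
Variables (P : probability T R) (Y : nat -> {RV P >-> nat}).
Implicit Types (x z : R) (w : T).

Let inc w : nat -> nat := fun n => Y n w.

Lemma walkE x n w : walk Y x n w = trajectory x (inc w) n.
Proof. by elim: n => [|n IH] //=; rewrite IH. Qed.

Lemma reflectsE x w m :
  reflects Y x w m.+1 <-> (trajectory x (inc w) m <= (inc w m)%:R)%R.
Proof.
rewrite /= walkE -subr_le0; set a := (_ - _)%R.
split=> [e|a0]; last by rewrite ler0_norm.
by rewrite -oppr_ge0 -e.
Qed.

Lemma reflection_timeE x k w n :
  reflection_time Y x k w = Some n <-> first_passage x k (inc w) n.
Proof.
elim: k n => [|k IH] n.
  split=> [[<-]//|[_ h]]; case: n h => // n h.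
  by have := h 0%N isT.
rewrite /=; case E : (reflection_time Y x k w) => [m|]; last first.
  split=> // -[en hn]; exfalso.
  have ex : exists m, (k <= reflections x (inc w) m)%N by exists n; rewrite en.
  case: (ex_minnP ex) => m km mmin.
  have below j : (j < m)%N -> (reflections x (inc w) j < k)%N.
    by move=> jm; rewrite ltnNge; apply/negP => /mmin; rewrite leqNgt jm.
  suff : reflection_time Y x k w = Some m by rewrite E.
  apply/IH; split => //; case: m km mmin below => [|m] /= km mmin below.
    by move: km; rewrite leqn0 => /eqP.
  by have := below m (ltnSn m); move: km; case: (_ <= _)%R => /=; lia.
have /IH[em hm] := E.
apply: (iff_trans (firstP _ _)); split.
  move=> [[mn rn] hn].
  have same j : (m <= j)%N -> (j < n)%N -> reflections x (inc w) j = k.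
    elim: j => [|j IHj] mj jn; first by move: mj em; rewrite leqn0 => /eqP ->.
    have [ej|nj] := eqVneq m j.+1; first by rewrite -ej.
    have mj' : (m <= j)%N by lia.
    rewrite /= IHj//; last lia.
    case rj : (_ <= _)%R; last by rewrite addn0.
    by case: (hn _ jn); split; [lia|apply/reflectsE].
  split.
    case: n mn rn hn same => // n mn /reflectsE rn hn same.
    by rewrite /= rn same//= addn1.
  move=> j jn; have [mj|jm] := leqP m j; first by rewrite same.
  by have := hm j jm; lia.
move=> [en hn].
have mn : (m < n)%N.
  rewrite ltnNge; apply/negP => nm.
  by have := reflections_le x (inc w) nm; rewrite en em ltnn.
split.
  split => //; case: n mn en hn => // n mn en hn; apply/reflectsE.
  have := hn n (ltnSn n); move: en => /=.
  by case: (_ <= _)%R => //=; lia.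
move=> [|j] jn [mj rj] //; move/reflectsE : rj => rj.
have := hn _ jn; rewrite /= rj.
have := reflections_le x (inc w) (n := j) mj; rewrite em /=; lia.
Qed.

(** The excluded value -1 encodes an infinite reflection time. *)
Lemma reflection_processE x k w z : z <> -1 ->
  reflection_process Y x k w = z <-> reflected_at x k (inc w) z.
Proof.
move=> z1; rewrite /reflection_process.
case E : (reflection_time Y x k w) => [m|].
  have /reflection_timeE fm := E; rewrite walkE; split=> [<-|]; first by exists m.
  by move=> [n [fn <-]]; rewrite (first_passage_inj fm fn).
split=> [e|[n [/reflection_timeE fn _]]]; first by case: z1.
by rewrite E in fn.
Qed.

End processes_as_trajectories.

(** * Paths between the states of a class *)

Section generated_subgroup.
Variable A : set nat.
Implicit Types (z : int) (B : nat).

(** z lies in the subgroup generated by the elements of A that are at most B. *)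
Definition generated B z := forall G : int -> Prop, G 0 ->
  (forall a b, G a -> G b -> G (a + b)) ->
  (forall a, A a -> (a <= B)%N -> G a%:Z /\ G (- a%:Z)) -> G z.

Lemma generated0 B : generated B 0. Proof. by move=> G. Qed.

Lemma generatedD B a b : generated B a -> generated B b -> generated B (a + b).
Proof. by move=> ha hb G G0 GD GA; exact: GD (ha G G0 GD GA) (hb G G0 GD GA). Qed.

Lemma generatedN B a : generated B a -> generated B (- a).
Proof.
move=> ha G G0 GD GA; apply: (ha (fun z => G (- z))).
- by rewrite oppr0.
- by move=> b c Gb Gc; rewrite opprD; exact: GD.
- by move=> b Ab bB; rewrite opprK; have [h1 h2] := GA b Ab bB; split.
Qed.

Lemma generated_le B B' a : (B <= B')%N -> generated B a -> generated B' a.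
Proof.
move=> BB' ha G G0 GD GA; apply: ha => // b Ab bB.
by apply: GA => //; exact: leq_trans BB'.
Qed.

Lemma generated_mulz B a k : generated B a -> generated B (k * a).
Proof.
move=> ha; have nat_mul (n : nat) : generated B (n%:Z * a).
  elim: n => [|n IH]; first by rewrite mul0r; exact: generated0.
  by rewrite intS mulrDl mul1r; exact: generatedD.
case: k => n; first exact: nat_mul.
by rewrite NegzE mulNr; apply: generatedN; exact: nat_mul.
Qed.

(** By Bezout the least positive element of the subgroup generated by A divides
every element of A; it only involves finitely many of them. *)
Lemma gcd_set_generated : (exists a, A a /\ (0 < a)%N) ->
  exists B, generated B (gcd_set A)%:Z.
Proof.
move=> [a0 [Aa0 a0_gt0]].
pose Q g := (0 < g)%N /\ exists B, generated B g%:Z.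
have QA a : A a -> generated a a%:Z.
  by move=> Aa G G0 GD GA; have [] := GA a Aa (leqnn a).
have exQ : exists g, `[< Q g >].
  by exists a0; apply/asboolP; split=> //; exists a0; exact: QA.
case: (ex_minnP exQ) => g /asboolP[g_gt0 [B gB]] gmin.
have g_dvd a : A a -> (g %| a)%N.
  move=> Aa; suff /gmin le_g : `[< Q (gcdn g a) >].
    have : gcdn g a = g.
      by apply/eqP; rewrite eqn_leq le_g dvdn_leq// dvdn_gcdl.
    by move=> <-; exact: dvdn_gcdr.
  apply/asboolP; split; first by rewrite gcdn_gt0 g_gt0.
  exists (maxn B a); have [u [v uv]] := Bezoutz g%:Z a%:Z.
  have -> : (gcdn g a)%:Z = gcdz g%:Z a%:Z by [].
  rewrite -uv; apply: generatedD.
    apply: generated_mulz.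
    exact: generated_le (leq_maxl _ _) gB.
  apply: generated_mulz.
  exact: generated_le (leq_maxr _ _) (QA a Aa).
have [_ /(_ g g_dvd)/dvdnP[m ->]] := gcd_setP A.
by exists B; rewrite PoszM; exact: generated_mulz.
Qed.

End generated_subgroup.

Section reachability.
Context {R : realType} (A : set nat).
Implicit Types x y z : R.

(** y can be reached from x with increments in A. *)
Inductive reach : R -> R -> Prop :=
| reach_refl x : reach x x
| reach_step x s y : A s -> reach `|x - s%:R| y -> reach x y.

Lemma reach_trans x y z : reach x y -> reach y z -> reach x z.
Proof. by elim=> // x' s y' As _ IH /IH; exact: reach_step. Qed.

Lemma reach1 x s : A s -> reach x `|x - s%:R|.
Proof. by move=> As; apply: (reach_step As); exact: reach_refl. Qed.

Lemma reach_flip x M : A M -> x <= M%:R -> reach x (M%:R - x).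
Proof.
by move=> AM xM; have := reach1 x AM; rewrite distrC ger0_norm// subr_ge0.
Qed.

(** Flip, take the step s, and flip again if no reflection occurred. *)
Lemma reach_rotate x s M : A s -> A M -> (s <= M)%N -> 0 <= x <= M%:R ->
  exists x', [/\ 0 <= x' <= M%:R, reach x x' &
    x' = x + s%:R \/ x' = x + s%:R - M%:R].
Proof.
move=> As AM sM /andP[x0 xM].
have sM' : s%:R <= M%:R :> R by rewrite ler_nat.
have s0 : 0 <= s%:R :> R by [].
have flip := reach_flip AM xM.
have flip' := reach_trans flip (reach1 _ As).
have [xs|xs] := leP (x + s%:R) M%:R.
  exists (x + s%:R); split; [by rewrite xs addr_ge0| |by left].
  rewrite ger0_norm in flip'; last by lra.
  have h : M%:R - x - s%:R <= M%:R :> R by lra.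
  have := reach_trans flip' (reach_flip AM h).
  by have -> : M%:R - (M%:R - x - s%:R) = x + s%:R :> R by ring.
exists (x + s%:R - M%:R); split; [by apply/andP; split; lra| |by right].
rewrite ler0_norm in flip'; last by lra.
by have -> : x + s%:R - M%:R = - (M%:R - x - s%:R) by ring.
Qed.

Lemma reach_modulo x M (z : int) : A M -> (0 < M)%N -> 0 <= x <= M%:R ->
  generated A M z ->
  exists x' (k : int), [/\ 0 <= x' <= M%:R, reach x x' &
    x' = x + z%:~R + k%:~R * M%:R].
Proof.
move=> AM M0 xM gz; pose G (a : int) := forall y : R, 0 <= y <= M%:R ->
  exists y' (k : int), [/\ 0 <= y' <= M%:R, reach y y' &
    y' = y + a%:~R + k%:~R * M%:R].
suff : G z by exact.
move: gz => /(_ G); apply => {x z xM}.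
- by move=> x x0M; exists x, 0; split => //; [exact: reach_refl|rewrite mul0r !addr0].
- move=> a b Ga Gb x /Ga[x1 [k1 [x1M r1 e1]]].
  have [x2 [k2 [x2M r2 e2]]] := Gb _ x1M.
  exists x2, (k1 + k2); split=> //; first exact: reach_trans r1 r2.
  by rewrite e2 e1 !rmorphD/=; ring.
move=> s As sM.
have pos n x : 0 <= x <= M%:R -> exists x' (k : int),
    [/\ 0 <= x' <= M%:R, reach x x' & x' = x + (n * s)%:R + k%:~R * M%:R].
  elim: n x => [|n IH] x x0M.
    by exists x, 0; split => //; [exact: reach_refl|rewrite mul0n mul0r !addr0].
  have [x1 [k1 [x1M r1 e1]]] := IH _ x0M.
  have [x2 [x2M r2 e2]] := reach_rotate As AM sM x1M.
  have r := reach_trans r1 r2.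
  case: e2 => e2; [exists x2, k1|exists x2, (k1 - 1)]; split => //.
    by rewrite e2 e1 mulSn natrD; ring.
  by rewrite e2 e1 mulSn natrD rmorphB/=; ring.
split=> x x0M.
  have [x1 [k1 [x1M r1 e1]]] := pos 1%N x x0M.
  by exists x1, k1; split => //; rewrite e1 mul1n.
(* Modulo M, the translation by -s is M - 1 translations by s. *)
have [x1 [k1 [x1M r1 e1]]] := pos M.-1 x x0M.
exists x1, (k1 + s%:Z); split => //; rewrite e1 rmorphN rmorphD/=.
have -> : (M.-1 * s)%:R = M%:R * s%:R - s%:R :> R.
  by rewrite -{2}(prednK M0) -addn1 natrD natrM; ring.
have -> : s%:~R = s%:R :> R by [].
by ring.
Qed.

Lemma reach_congruent x y M (k : int) : A M -> (0 < M)%N ->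
  0 <= x <= M%:R -> 0 <= y <= M%:R -> x = y + k%:~R * M%:R -> reach x y.
Proof.
move=> AM M0 /andP[x0 xM] /andP[y0 yM] e.
have M0' : 0 < M%:R :> R by rewrite ltr0n.
have k1 : k < 2.
  rewrite -(ltr_int R) -(ltr_pM2r M0'); lra.
have k2 : -2 < k.
  rewrite -(ltr_int R) -(ltr_pM2r M0') rmorphN/=; lra.
have : [\/ k = 0, k = 1 | k = -1].
  by case: k k1 k2 {e} => [[|[|n]]|[|n]]// _ _; constructor.
case=> ek; rewrite ek in e.
- by rewrite e mul0r addr0; exact: reach_refl.
- have -> : y = M%:R - x by move: e; rewrite mul1r; lra.
  exact: reach_flip.
- have -> : y = M%:R - x by move: e; rewrite rmorphN/= mulN1r; lra.
  exact: reach_flip.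
Qed.

(** Take M in A above x and y such that the elements of A below M generate
gcd(A) Z: this is possible both for bounded A, where M is the maximum, and for
unbounded A. Then [reach_modulo] reaches all points of the same progression as
x modulo M, and a first flip reaches the opposite progression. *)
Lemma reach_class (x0 x y : R) (t u : nat) : A t -> A u -> x <= t%:R -> y <= u%:R ->
  (exists a, A a /\ (0 < a)%N) ->
  0 <= x -> 0 <= y ->
  symmetric_point (gcd_set A) x0 x -> symmetric_point (gcd_set A) x0 y ->
  reach x y.
Proof.
move=> At Au xt yu pos x_ge0 y_ge0 [k ek] [l el].
have [B gB] := gcd_set_generated pos; set d := gcd_set A in gB ek el.
have dA a : A a -> (d %| a)%N by have [h _] := gcd_setP A; exact: h.
have [a0 [Aa0 a0_gt0]] := pos.
pose L := maxn (maxn B a0) (maxn t u).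
have [M [AM genM tM uM a0M]] : exists M, [/\ A M, generated A M d%:Z,
    (t <= M)%N, (u <= M)%N & (a0 <= M)%N].
  have [[M [AM LM]]|nM] := pselect (exists M, A M /\ (L <= M)%N).
    exists M; split => //; try by apply: leq_trans LM; rewrite /L !leq_max leqnn ?orbT.
    by apply: generated_le gB; apply: leq_trans LM; rewrite /L !leq_max leqnn.
  have exA : exists a, `[< A a >] by exists a0; apply/asboolP.
  have bound a : `[< A a >] -> (a <= L)%N.
    move=> /asboolP Aa; rewrite leqNgt; apply/negP => La.
    by apply: nM; exists a; split=> //; exact: ltnW.
  case: (ex_maxnP exA bound) => M /asboolP AM Mmax.
  have le_M a : A a -> (a <= M)%N by move=> Aa; apply: Mmax; apply/asboolP.
  exists M; split=> //; try exact: le_M.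
  by move=> G G0 GD GA; apply: gB => // a Aa _; apply: GA => //; exact: le_M.
have M0 : (0 < M)%N := leq_trans a0_gt0 a0M.
have x0M : 0 <= x <= M%:R by rewrite x_ge0 (le_trans xt)// ler_nat.
have y0M : 0 <= y <= M%:R by rewrite y_ge0 (le_trans yu)// ler_nat.
have [m Mm] := dvdnP (dA M AM).
have goal z (j : int) : 0 <= z <= M%:R -> y = z + j%:~R * d%:R -> reach z y.
  move=> z0M e.
  have [z' [n [z'M r e']]] := reach_modulo AM M0 z0M (generated_mulz j genM).
  apply: reach_trans r (reach_congruent AM M0 z'M y0M (k := n) _).
  by rewrite e' e rmorphM/=.
have flip (j : int) : y = - x + j%:~R * d%:R -> reach x y.
  move=> e; apply: reach_trans (reach_flip AM _) (goal _ (j - m%:Z) _ _).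
  - by case/andP: x0M.
  - by case/andP: x0M => ? ?; apply/andP; split; lra.
  rewrite e Mm natrM rmorphB/=; have -> : m%:~R = m%:R :> R by [].
  by ring.
case: ek => ex; case: el => ey.
- by apply: (goal x (l - k)) => //; rewrite ex ey /progression rmorphB/=; ring.
- by apply: (flip (k - l)); rewrite ex ey /progression rmorphB/=; ring.
- by apply: (flip (l - k)); rewrite ex ey /progression rmorphB/=; ring.
- by apply: (goal x (k - l)) => //; rewrite ex ey /progression rmorphB/=; ring.
Qed.

End reachability.

(** * First-step analysis *)

Section first_step_analysis.
Context {disp : measure_display} {T : measurableType disp} {R : realType}.
Variables (P : probability T R) (Y : nat -> {RV P >-> nat}).
Variable (mu : probability nat R).
Hypothesis hY : iid_with_law Y mu.
Implicit Types (A B : (nat -> nat) -> Prop) (x y z : R).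
Local Open Scope ereal_scope.

Let p := law mu.
Let p_ge0 s : 0 <= p s := law_ge0 mu s.
Let Pr A := P (event Y A).

Lemma prob_event_eq A B : (forall w, A w <-> B w) -> Pr A = Pr B.
Proof. by move=> AB; congr (P _); apply/seteqP; split=> t /AB. Qed.

Lemma prob_event_and (b : bool) A : Pr (fun w => b /\ A w) = ind b * Pr A.
Proof.
case: b => /=.
  by rewrite mul1e; apply: prob_event_eq => w; split=> [[]|].
rewrite mul0e -(measure0 P); congr (P _).
by apply/seteqP; split=> [t []|].
Qed.

Lemma prob_event_const (b : bool) : Pr (fun=> b) = ind b.
Proof.
have -> : Pr (fun=> b) = Pr (fun w => b /\ True).
  by apply: prob_event_eq => w; split=> [|[]].
rewrite prob_event_and; have -> : Pr (fun=> True) = 1 by exact: probability_setT.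
by rewrite mule1.
Qed.

Lemma prob_event_le1 A : open_event A -> Pr A <= 1.
Proof. by move=> oA; apply: probability_le1; exact: (measurable_open hY). Qed.

Lemma walk_first_step A (B : R -> (nat -> nat) -> Prop) y : open_event A ->
  (forall s w, A (scons s w) <-> B `|y - s%:R|%R w) ->
  Pr A = walk_step p y (fun z => Pr (B z)).
Proof.
move=> oA AB; rewrite /Pr (markov_property hY)//.
by apply: eq_esum => s _; congr (_ * _); exact: prob_event_eq.
Qed.

Lemma prob_walk_hits0 x y :
  Pr (hits walk_at x 0 y) = walk_step p y (fun z => ind (z == x)).
Proof.
rewrite (@walk_first_step _ (fun z _ => z == x) y).
- by apply: eq_esum => s _; rewrite prob_event_const.
- exact: open_walk_hits.
- by move=> s w; apply: (iff_trans (walk_hits0 _ _ _ _)); split=> /eqP.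
Qed.

Lemma prob_walk_hitsS x k y : Pr (hits walk_at x k.+1 y) =
  walk_step p y (fun z => ind (z != x) * Pr (hits walk_at x k z)).
Proof.
rewrite (@walk_first_step _ (fun z w => z != x /\ hits walk_at x k z w) y).
- by apply: eq_esum => s _; rewrite prob_event_and.
- exact: open_walk_hits.
- move=> s w; apply: (iff_trans (walk_hitsS _ _ _ _ _)).
  by split=> -[/eqP ? ?].
Qed.

(** For a quantity that restarts at a reflection (B) and is unchanged by free
steps (A). *)
Lemma reflected_first_step (A B : R -> (nat -> nat) -> Prop) y :
  (forall z, open_event (A z)) ->
  (forall s w, A y (scons s w) <->
    if (y <= s%:R)%R then B (s%:R - y)%R w else A (y - s%:R)%R w) ->
  Pr (A y) = reflected_step p y (fun z => Pr (B z)) +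
             free_step p y (fun z => Pr (A z)).
Proof.
move=> oA AB; have PrE := markov_property hY (oA y).
rewrite /Pr PrE -esumD; last 2 first.
- by move=> s _; rewrite !mule_ge0 ?ind_ge0.
- by move=> s _; rewrite !mule_ge0 ?ind_ge0.
apply: eq_esum => s _; have := AB s; case: (leP y s%:R) => ys ABs.
  rewrite /= mule1 mule0 mul0e adde0; congr (_ * _); exact: prob_event_eq.
rewrite /= mule1 mule0 mul0e add0e; congr (_ * _); exact: prob_event_eq.
Qed.

Hypothesis p0_lt1 : p 0%N < 1.
Let p_sum1 : \esum_(s in setT) p s = 1 := law_sum1 mu.

Lemma prob_reflection_kernel (A B : R -> (nat -> nat) -> Prop) y :
  (forall z, open_event (A z)) -> (forall z, Pr (B z) <= 1) ->
  (forall y s w, A y (scons s w) <->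
    if (y <= s%:R)%R then B (s%:R - y)%R w else A (y - s%:R)%R w) ->
  Pr (A y) = reflection_kernel p y (fun z => Pr (B z)).
Proof.
move=> oA B1 AB.
apply: (reflection_kernel_unique p_ge0 p_sum1 p0_lt1 (F := fun y => Pr (A y))).
- by move=> z; rewrite measure_ge0 B1.
- by move=> z; rewrite measure_ge0 prob_event_le1.
- by move=> z; exact: reflected_first_step.
Qed.

Lemma prob_reflected_hits0 x y : Pr (hits reflected_at x 0 y) =
  reflection_kernel p y (fun z => ind (z == x)).
Proof.
rewrite (@prob_reflection_kernel (hits reflected_at x 0) (fun z _ => z == x)).
- apply: (functional_eq (reflection_kernel_functional p_ge0 y)) => z.
    exact: measure_ge0.
  by rewrite prob_event_const.
- by move=> z; exact: open_reflected_hits.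
- by move=> z; rewrite prob_event_const ind_le1.
- move=> z s w; apply: (iff_trans (reflected_hits0 _ _ _ _)).
  by case: ifP => _ //; split=> /eqP.
Qed.

Lemma prob_reflected_hitsS x k y : Pr (hits reflected_at x k.+1 y) =
  reflection_kernel p y (fun z => ind (z != x) * Pr (hits reflected_at x k z)).
Proof.
rewrite (@prob_reflection_kernel (hits reflected_at x k.+1)
  (fun z w => z != x /\ hits reflected_at x k z w)).
- apply: (functional_eq (reflection_kernel_functional p_ge0 y)) => z.
    exact: measure_ge0.
  by rewrite prob_event_and.
- by move=> z; exact: open_reflected_hits.
- move=> z; rewrite prob_event_and; case: (z != x); rewrite /= ?mul1e ?mul0e ?lee01//.
  by apply: prob_event_le1; exact: open_reflected_hits.
- move=> z s w; apply: (iff_trans (reflected_hitsS _ _ _ _ _)).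
  case: ifP => _ //.
  by split=> -[/eqP ? ?].
Qed.

Lemma prob_event_gt0 A s : open_event A -> 0 < p s ->
  0 < Pr (fun w => A (scons s w)) -> 0 < Pr A.
Proof.
move=> oA ps pA; rewrite /Pr (markov_property hY oA).
apply: lt_le_trans (le_term_esum s _); first exact: mule_gt0.
by move=> j; rewrite mule_ge0.
Qed.

Lemma prob_trajectory_gt0 x y : reach (supp mu) x y ->
  exists n, 0 < Pr (fun w => trajectory x w n = y).
Proof.
elim=> {x y} [x|x s y ps _ [n pn]].
  exists 0%N; suff -> : Pr (fun w => trajectory x w 0 = x) = 1 by rewrite lte01.
  by rewrite -[RHS](prob_event_const true); apply: prob_event_eq => w; split.
exists n.+1; apply: (@prob_event_gt0 _ s) => //.
  apply: (@determined_open n.+1) => w w' ww'.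
  by rewrite (trajectory_agree _ ww').
rewrite (@prob_event_eq _ (fun w => trajectory (`|x - s%:R|)%R w n = y))//.
by move=> w; rewrite trajectory_scons.
Qed.

(** Reach z first; the step s is then a reflection to s - z. *)
Lemma prob_reflected_at_gt0 x z s : reach (supp mu) x z -> supp mu s ->
  (z <= s%:R)%R ->
  exists k, 0 < Pr (fun w => reflected_at x k.+1 w (s%:R - z)%R).
Proof.
move=> r ps; elim: r => {x z} [x|x t y pt _ IH] zs.
  exists 0%N; apply: (@prob_event_gt0 _ s) => //; first exact: open_reflected_at.
  suff -> : Pr (fun w => reflected_at x 1 (scons s w) (s%:R - x)%R) = 1.
    by rewrite lte01.
  rewrite -[RHS](prob_event_const true); apply: prob_event_eq => w; split => // _.
  by apply/reflected_at_scons; rewrite zs; exact/reflected_at0.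
have [k pk] := IH zs.
have [xt|tx] := leP x t%:R.
  exists k.+1; apply: (@prob_event_gt0 _ t) => //; first exact: open_reflected_at.
  rewrite (prob_event_eq (fun w => reflected_at_scons _ _ _ _ _)) xt.
  by move: pk; rewrite distrC ger0_norm ?subr_ge0.
exists k; apply: (@prob_event_gt0 _ t) => //; first exact: open_reflected_at.
rewrite (prob_event_eq (fun w => reflected_at_scons _ _ _ _ _)) leNgt tx /=.
by move: pk; rewrite ger0_norm// subr_ge0 ltW.
Qed.

End first_step_analysis.

(** * Recurrence *)

Section state_space.
Context {R : realType} (mu : probability nat R).
Hypothesis hmu : nonconstant mu.
Implicit Types (x y z : R).
Local Open Scope ereal_scope.

Let p := law mu.
Let d := gcd_set (supp mu).
Let p_ge0 s : 0 <= p s := law_ge0 mu s.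
Let p_sum1 : \esum_(s in setT) p s = 1 := law_sum1 mu.

Lemma law_0_lt1 : law mu 0%N < 1.
Proof.
rewrite lt_neqAle probability_le1// andbT; apply/eqP => e.
by apply: hmu; exists 0%N.
Qed.

Lemma positive_step : exists s, supp mu s /\ (0 < s)%N.
Proof.
apply/not_existsP => none; have := law_0_lt1; rewrite lt_neqAle => /andP[/eqP h _].
apply: h; rewrite -p_sum1 (esum_single (i := 0%N))// => s s0.
apply/eqP; rewrite eq_le p_ge0 andbT leNgt; apply/negP => ps.
by apply: (none s); split; [exact: ps|rewrite lt0n].
Qed.

Lemma gcd_supp_dvd s : 0 < law mu s -> (gcd_set (supp mu) %| s)%N.
Proof. by move=> ps; have [h _] := gcd_setP (supp mu); exact: h. Qed.

Lemma gcd_supp_gt0 : (0 < gcd_set (supp mu))%N.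
Proof.
have [s [/gcd_supp_dvd ds s0]] := positive_step.
by rewrite lt0n; apply: contraTneq ds => ->; rewrite dvd0n -lt0n.
Qed.

(** The supremum of a set of integers is attained if it is finite, so being at
most N means being at most some point of the support. *)
Lemma C_setE x0 z : C_set mu x0 z <-> in_range p d x0 z.
Proof.
have S_point : S_set mu x0 z <-> (0 <= z)%R /\ symmetric_point d x0 z.
  split=> -[z0 [k e]]; split => //.
    case: e => e; first by exists k; left.
    by exists (- k)%R; right; rewrite e /progression rmorphN/=; ring.
  case: e => e; first by exists k; left.
  by exists (- k)%R; right; rewrite e /progression rmorphN/=; ring.
split=> [[/S_point[z0 zp] zN]|[zp z0 [t [pt zt]]]]; last first.
  split; first exact/S_point.
  apply: (@le_trans _ _ t%:R%:E); first by rewrite lee_fin.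
  by apply: ereal_sup_ubound; exists t.
split => //; apply: contrapT => none.
have below t : supp mu t -> (t%:R < z)%R.
  by move=> pt; rewrite ltNge; apply/negP => zt; apply: none; exists t.
have exn : exists n : nat, (z <= n%:R)%R.
  by exists (Num.bound z); rewrite ltW// archi_boundP.
case: (ex_minnP exn) => n zn nmin.
have [s [ps s0]] := positive_step.
have n0 : (0 < n)%N by rewrite -(ltr_nat R) (le_lt_trans _ (lt_le_trans (below s ps) zn)).
have n1z : (n.-1%:R < z)%R.
  by rewrite ltNge; apply/negP => /nmin; rewrite leqNgt prednK// leqnn.
suff : supN mu <= n.-1%:R%:E by move=> /(le_trans zN); rewrite lee_fin leNgt n1z.
apply: ge_ereal_sup => _ [t pt <-]; rewrite lee_fin ler_nat -ltnS prednK//.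
by rewrite -(ltr_nat R) (lt_le_trans (below t pt)).
Qed.

Lemma symmetric_pointN x0 z : symmetric_point d x0 z -> symmetric_point d x0 (- z)%R.
Proof. by move=> [k [->|->]]; exists k; [right|left; rewrite opprK]. Qed.

Lemma symmetric_pointD x0 s z : supp mu s -> symmetric_point d x0 z ->
  symmetric_point d x0 (z + s%:R)%R.
Proof.
move=> /gcd_supp_dvd/dvdnP[m ->] [k [->|->]].
  exists (k + m%:Z)%R; left; rewrite /progression rmorphD/= natrM.
  by have -> : (m%:~R = m%:R :> R)%R by []; ring.
exists (k - m%:Z)%R; right; rewrite /progression rmorphB/= natrM.
by have -> : (m%:~R = m%:R :> R)%R by []; ring.
Qed.

Lemma in_range_reflected x0 z s : in_range p d x0 z -> supp mu s ->
  (z <= s%:R)%R -> in_range p d x0 (s%:R - z)%R.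
Proof.
move=> [zp z0 _] ps zs; split.
- by rewrite addrC; apply: symmetric_pointD => //; exact: symmetric_pointN.
- by rewrite subr_ge0.
- by exists s; split; [exact: ps|rewrite lerBlDr lerDl].
Qed.

Lemma in_range_free x0 z s : in_range p d x0 z -> supp mu s ->
  (s%:R < z)%R -> in_range p d x0 (z - s%:R)%R.
Proof.
move=> [zp z0 [t [pt zt]]] ps sz; split.
- rewrite -opprB addrC; apply: symmetric_pointN; apply: symmetric_pointD => //.
  exact: symmetric_pointN.
- by rewrite subr_ge0 ltW.
- by exists t; split => //; rewrite lerBlDr (le_trans zt)// lerDl.
Qed.

Lemma in_range_walk x0 z s : in_range p d x0 z -> supp mu s ->
  in_range p d x0 `|z - s%:R|%R.
Proof.
move=> rz ps; have [zs|sz] := leP z s%:R.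
  by rewrite distrC ger0_norm ?subr_ge0//; exact: in_range_reflected.
by rewrite ger0_norm ?subr_ge0 ?ltW//; exact: in_range_free.
Qed.

Lemma in_range_step x0 z : in_range p d x0 z ->
  exists s, [/\ supp mu s, (0 < s)%N & (z <= s%:R)%R].
Proof.
move=> [_ z0 [t [pt zt]]]; have [s [ps s0]] := positive_step.
have [t0|t0] := posnP t; last by exists t.
by exists s; split => //; rewrite (le_trans zt)// t0.
Qed.

Lemma in_range_nonempty x0 : exists z, in_range p d x0 z.
Proof.
have [k /andP[lo hi]] := progression_meets_period x0 gcd_supp_gt0 0.
have [s [ps s0]] := positive_step.
exists (progression d x0 k); split.
- by exists k; left.
- by rewrite (le_trans _ lo).
- exists s; split; first exact: ps.
  apply: ltW; apply: lt_le_trans hi _; rewrite mul1n ler_nat dvdn_leq//.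
  exact: gcd_supp_dvd.
Qed.

Lemma reach_in_range x0 x y : in_range p d x0 x -> in_range p d x0 y ->
  reach (supp mu) x y.
Proof.
move=> [xp x_ge0 [t [pt xt]]] [yp y_ge0 [u [pu yu]]].
exact: (reach_class pt pu xt yu positive_step x_ge0 y_ge0 xp yp).
Qed.

End state_space.

Section recurrence.
Context {disp : measure_display} {T : measurableType disp} {R : realType}.
Variables (P : probability T R) (Y : nat -> {RV P >-> nat}).
Variable (mu : probability nat R).
Hypothesis hY : iid_with_law Y mu.
Hypothesis hmu : nonconstant mu.
Implicit Types (x y z : R).
Local Open Scope ereal_scope.

Let p := law mu.
Let d := gcd_set (supp mu).
Let p_ge0 s : 0 <= p s := law_ge0 mu s.
Let p_sum1 : \esum_(s in setT) p s = 1 := law_sum1 mu.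
Let p0_lt1 : p 0%N < 1 := law_0_lt1 hmu.
Let d_gt0 : (0 < d)%N := gcd_supp_gt0 hmu.
Let p_dvd s : 0 < p s -> (d %| s)%N := @gcd_supp_dvd _ mu s.

Lemma return_time_hits (Z : R -> nat -> T -> R)
    (at_state : R -> nat -> (nat -> nat) -> R -> Prop) x k w :
  (forall n, Z x n.+1 w = x <-> at_state x n.+1 (fun i => Y i w) x) ->
  return_time Z x w = Some k.+1 <-> event Y (hits at_state x k x) w.
Proof.
move=> ZE; apply: (iff_trans (firstP _ _)); split.
  move=> [[_ e] h]; split; first exact/ZE.
  by move=> j jk /(ZE j) zj; apply: (h j.+1).
move=> [e h]; split; first by split => //; exact/ZE.
by move=> [|j] jk [// _ /(ZE j)]; exact: h.
Qed.

Lemma hits_trivIset (at_state : R -> nat -> (nat -> nat) -> R -> Prop) x y :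
  trivIset setT (fun k => event Y (hits at_state x k y)).
Proof.
move=> i j _ _ [w [[ei hi] [ej hj]]].
case: (ltngtP i j) => // [ij|ji]; first by case: (hj i ij).
by case: (hi j ji).
Qed.

Lemma walk_essential x0 : essential_class P (walk Y) (C_set mu x0).
Proof.
split; last split.
- by have [z rz] := in_range_nonempty hmu x0; exists z; exact/C_setE.
- move=> x /(C_setE hmu) rx.
  pose A (w : nat -> nat) := C_set mu x0 `|x - (w 0%N)%:R|%R.
  have dA : determined 1 A by move=> w w' ww'; rewrite /A (ww' 0%N).
  have -> : [set w | C_set mu x0 (walk Y x 1 w)] = event Y A by [].
  rewrite (markov_determined hY dA) -[RHS]p_sum1.
  apply: eq_esum => s _.
  have [ps|ps] := eqVneq (p s) 0; first by rewrite -/p ps mul0e.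
  rewrite -[RHS]mule1; congr (_ * _).
  have rs : C_set mu x0 `|x - s%:R|%R.
    apply/C_setE => //; apply: in_range_walk => //.
    by rewrite /supp/= lt_def ps p_ge0.
  rewrite -[RHS](prob_event_const Y true).
  by apply: prob_event_eq => w; split.
move=> x y /(C_setE hmu) rx /(C_setE hmu) ry.
have [n pn] := prob_trajectory_gt0 hY (reach_in_range hmu rx ry).
exists n; move: pn; congr (_ < P _).
by apply/seteqP; split=> w; rewrite /event/= walkE.
Qed.

Lemma in_range_neqN1 x0 z : in_range p d x0 z -> z <> (-1)%R.
Proof. by move=> [_ z0 _] e; move: z0; rewrite e oppr_ge0 ler10. Qed.

Lemma reflection_essential x0 :
  essential_class P (reflection_process Y) (C_set mu x0).
Proof.
split; last split.
- by have [z rz] := in_range_nonempty hmu x0; exists z; exact/C_setE.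
- move=> x /(C_setE hmu) rx.
  pose A z (w : nat -> nat) := exists y, C_set mu x0 y /\ reflected_at z 1 w y.
  have oA z : open_event (A z).
    move=> w [y [Cy /open_reflected_at[n h]]].
    by exists n => w' /h ?; exists y.
  have -> : [set w | C_set mu x0 (reflection_process Y x 1 w)] = event Y (A x).
    apply/seteqP; split=> w.
      move=> Cw; exists (reflection_process Y x 1 w); split => //.
      apply/reflection_processE => //.
      exact: in_range_neqN1 ((C_setE hmu x0 _).1 Cw).
    move=> [y [Cy zy]].
    have y1 : y <> (-1)%R by apply: in_range_neqN1 ((C_setE hmu x0 y).1 Cy).
    by rewrite /= ((reflection_processE Y x 1 w y1).2 zy).
  pose B z (w : nat -> nat) := C_set mu x0 z.
  have AB z s w : A z (scons s w) <->
    if (z <= s%:R)%R then B (s%:R - z)%R w else A (z - s%:R)%R w.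
    rewrite /A /B; split.
      move=> [y [Cy /reflected_at_scons]]; case: ifP => _; last by exists y.
      by move/reflected_at0 => ->.
    case: ifP => zs.
      move=> Cz; exists (s%:R - z)%R; split => //; apply/reflected_at_scons.
      by rewrite zs; exact/reflected_at0.
    by move=> [y [Cy h]]; exists y; split => //; apply/reflected_at_scons; rewrite zs.
  apply: (bounded_solution_unique p_ge0 p_sum1 (D := in_range p d x0)
    (b := fun z => reflected_step p z (fun y => P (event Y (B y))))
    (F := fun z => P (event Y (A z))) (G := fun=> 1)) => //.
  + by move=> z s rz ps sz; exact: in_range_free.
  + move=> z; apply: (functional_ge0 (reflected_step_functional p_ge0 z)) => y.
    exact: measure_ge0.
  + by move=> z; rewrite measure_ge0 (prob_event_le1 hY (oA z)).
  + by move=> z; rewrite lexx lee01.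
  + by move=> z rz; exact: (reflected_first_step hY (B := B) oA (AB z)).
  + move=> z rz; rewrite -[LHS](step_split1 p_ge0 p_sum1 z); congr (_ + _).
    apply: eq_esum => s _.
    have [ps|ps] := eqVneq (p s) 0; first by rewrite ps !mul0e.
    case: (leP z s%:R) => zs; last by rewrite mule0 !mul0e.
    congr (_ * _); rewrite -[LHS](prob_event_const Y true).
    apply: prob_event_eq => w; split => // _; apply/C_setE => //.
    by apply: in_range_reflected => //; rewrite /supp/= lt_def ps p_ge0.
move=> x y /(C_setE hmu) rx /(C_setE hmu) ry.
have [s [ps s0 ys]] := in_range_step hmu ry.
have rz := in_range_reflected ry ps ys.
have zs : (s%:R - y <= s%:R)%R by case: ry => _ y0 _; rewrite lerBlDr lerDl.
have [k pk] := prob_reflected_at_gt0 hY (reach_in_range hmu rx rz) ps zs.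
exists k.+1; move: pk; rewrite subKr; congr (_ < P _).
by apply/seteqP; split=> w /(reflection_processE _ _ _ _ (in_range_neqN1 ry)).
Qed.

Lemma law_tailE k : law_tail p k = 1 - F_mu mu k.
Proof.
rewrite /F_mu -probability_setC//.
rewrite law_esum; apply: eq_esum => s _; congr (_ * ind _).
case: (ltnP k s) => ks; last by rewrite memNset//= => /(_ ks).
by rewrite mem_set//= => sk; rewrite leqNgt ks in sk.
Qed.

Hypothesis hF : \sum_(0 <= k <oo) (1 - F_mu mu k) ^+ 2 < +oo.

Lemma reflected_mass_fin x0 : reflected_stationary p d x0 (fun=> 1) < +oo.
Proof.
apply: le_lt_trans (reflected_mass_le x0 p_ge0 p_sum1 d_gt0) _.
rewrite lte_add_pinfty ?ltry// lte_mul_pinfty ?lee_fin//.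
move: hF; rewrite nneseries_esumT; last first.
  by move=> k; rewrite -law_tailE expe2 mule_ge0 ?law_tail_ge0.
by congr (_ < _); apply: eq_esum => k _; rewrite -law_tailE expe2.
Qed.

Lemma reflection_positive_recurrent x0 :
  positive_recurrent_on P (reflection_process Y) (C_set mu x0).
Proof.
split; first exact: reflection_essential.
move=> x /(C_setE hmu) rx.
apply: (@positive_recurrent_state _ _ _ P _ x
  (fun k y => event Y (hits reflected_at x k y)) _ _ _
  (reflected_stationary p d x0) (reflection_kernel p)).
- move=> k w; apply: return_time_hits => n.
  by apply: reflection_processE; exact: in_range_neqN1 rx.
- by move=> k y; apply: (measurable_open hY); exact: open_reflected_hits.
- by move=> y; exact: hits_trivIset.
- exact: reflected_stationary_functional.
- move=> f f01.
  exact: (reflected_invariant p_ge0 p_sum1 p_dvd p0_lt1 (reflected_mass_fin x0) f01).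
- by move=> y; exact: prob_reflected_hits0.
- by move=> k y; exact: prob_reflected_hitsS.
- have [s [ps s0 xs]] := in_range_step hmu rx.
  have [rp _ _] := in_range_reflected rx ps xs.
  by apply: (reflected_point_gt0 p_ge0 rp _ s0 ps); case: rx => _ -> _.
- exact: reflected_mass_fin.
Qed.

Lemma stationary_point_gt0 x0 x : in_range p d x0 x ->
  0 < stationary p d x0 (fun z => ind (z == x)).
Proof.
move=> rx; have [s [ps s0 xs]] := in_range_step hmu rx.
have [xp x_ge0 _] := rx.
apply: (stationary_gt0 p_ge0 (z := x) (t := s)) => //.
- by move=> z; exact: ind_ge0.
- by rewrite x_ge0.
- by rewrite eqxx lte01.
Qed.

Lemma mean_esum : mean mu = \esum_(t in setT) (p t * t%:R%:E).
Proof.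
rewrite /mean nneseries_esumT; last by move=> k; rewrite mule_ge0 ?lee_fin.
by apply: eq_esum => t _; rewrite muleC.
Qed.

Lemma stationary_mass_fin x0 : mean mu < +oo -> stationary p d x0 (fun=> 1) < +oo.
Proof.
rewrite mean_esum => fin.
apply: le_lt_trans (stationary_mass_le x0 p_ge0 d_gt0) _.
have -> : \esum_(t in [set: nat]) (p t * (t.+1 * 4)%:R%:E) =
    4%:R%:E * (\esum_(t in [set: nat]) (p t * t%:R%:E)) + 4%:R%:E.
  have four : 4%:R%:E = \esum_(s in [set: nat]) (p s * 4%:R%:E) :> \bar R.
    by rewrite esumZr ?lee_fin// p_sum1 mul1e.
  rewrite [X in _ = _ + X]four -esumZl ?lee_fin//; last first.
    by move=> t; rewrite mule_ge0 ?lee_fin.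
  rewrite -esumD; last 2 first.
  - by move=> t _; rewrite !mule_ge0 ?lee_fin.
  - by move=> t _; rewrite mule_ge0 ?lee_fin.
  apply: eq_esum => t _; rewrite muleCA -ge0_muleDr ?mule_ge0 ?lee_fin//.
  by congr (_ * _); rewrite -EFinM -EFinD -natrM -natrD; congr (_%:R%:E); lia.
by rewrite lte_add_pinfty ?ltry// lte_mul_pinfty ?lee_fin.
Qed.

Lemma stationary_mass_infinite x0 : mean mu = +oo -> stationary p d x0 (fun=> 1) = +oo.
Proof.
rewrite mean_esum => inf; apply/eqP; rewrite -leye_eq.
apply: le_trans (stationary_mass_ge x0 p_ge0 d_gt0 p_dvd).
have pd0 t : 0 <= p t * (t %/ d)%:R%:E by rewrite mule_ge0 ?lee_fin.
have : (d%:R%:E * (\esum_(t in [set: nat]) (p t * (t %/ d)%:R%:E)) = +oo :> \bar R)%E.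
  rewrite -inf -esumZl ?lee_fin//; apply: eq_esum => t _.
  have [pt|pt] := eqVneq (p t) 0; first by rewrite pt !mul0e mule0.
  rewrite muleCA; congr (_ * _); rewrite -EFinM -natrM mulnC divnK//.
  by apply: p_dvd; rewrite lt_def pt p_ge0.
by case: (\esum_(t in _) _) (esumT_ge0 pd0) => [r||].
Qed.

Definition returns x y (w : nat -> nat) := exists n, trajectory y w n.+1 = x.

Lemma open_returns x y : open_event (returns x y).
Proof.
move=> w [n e]; exists n.+1 => w' ww'; exists n.
by rewrite -(trajectory_agree _ ww').
Qed.

Lemma returns_scons x y s w :
  returns x y (scons s w) <-> `|y - s%:R|%R = x \/ returns x `|y - s%:R|%R w.
Proof.
split=> [[[|n]]|[e|[n e]]].
- by rewrite trajectory_scons; left.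
- by rewrite trajectory_scons => e; right; exists n.
- by exists 0%N; rewrite trajectory_scons.
- by exists n.+1; rewrite trajectory_scons.
Qed.

Lemma returnsE x y : event Y (returns x y) = \bigcup_k event Y (hits walk_at x k y).
Proof.
apply/seteqP; split=> t; last by move=> [k _ [e _]]; exists k.
move=> [n e].
have ex : exists n, trajectory y (fun i => Y i t) n.+1 == x by exists n; exact/eqP.
case: (ex_minnP ex) => k /eqP ek kmin; exists k => //; split => // j jk ej.
by have := kmin j; rewrite ej eqxx => /(_ isT); rewrite leqNgt jk.
Qed.

(** If x is almost surely visited from y, then it is almost surely visited from
every state that follows y with positive probability. *)
Lemma prob_returns_step x y s : P (event Y (returns x x)) = 1 ->
  P (event Y (returns x y)) = 1 -> supp mu s ->
  P (event Y (returns x `|y - s%:R|%R)) = 1.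
Proof.
move=> recx; set v := fun s : nat => P (event Y (returns x `|y - s%:R|%R)).
have v01 t : 0 <= v t <= 1.
  by rewrite /v measure_ge0 (prob_event_le1 hY (@open_returns _ _)).
move=> recy ps.
have [->//|ne] := eqVneq `|y - s%:R|%R x.
pose u t := P (event Y (fun w => returns x y (scons t w))).
have ou t : open_event (fun w => returns x y (scons t w)).
  by apply: open_scons; exact: open_returns.
have u0 t : 0 <= u t by exact: measure_ge0.
have u1 t : u t <= 1 by exact: (prob_event_le1 hY).
have ufin t : u t \is a fin_num by rewrite ge0_fin_numE// (le_lt_trans (u1 t))// ltry.
have us : u s = v s.
  apply: prob_event_eq => w; apply: (iff_trans (returns_scons _ _ _ _)).
  by split=> [[/eqP|]|]; [rewrite (negbTE ne)| |right].
have sum1 : (\esum_(t in setT) (p t * u t)) + \esum_(t in setT) (p t * (1 - u t)) = 1.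
  have c0 t : 0 <= 1 - u t by rewrite sube_ge0 ?ufin.
  rewrite -esumD; [|by move=> t _; rewrite mule_ge0|by move=> t _; rewrite mule_ge0].
  rewrite -[RHS]p_sum1; apply: eq_esum => t _.
  by rewrite -ge0_muleDr// [u t + _]addeC subeK// mule1.
have c0 t : 0 <= p t * (1 - u t) by rewrite mule_ge0// sube_ge0 ?ufin.
have : \esum_(t in setT) (p t * (1 - u t)) = 0.
  move: sum1; rewrite -(markov_property hY (@open_returns x y)) recy.
  case: (\esum_(t in _) _) => [r||]// [e]; congr (_%:E); lra.
move=> /(esum_eq0 c0)/(_ s)/eqP; rewrite mule_eq0.
have -> : (p s == 0) = false by apply/negbTE; rewrite gt_eqF.
move=> /eqP e; have := subeK 1 (ufin s); rewrite e add0e => us1.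
by rewrite -/(v s) -us.
Qed.

Lemma prob_returns_reach x y : P (event Y (returns x x)) = 1 ->
  reach (supp mu) x y -> P (event Y (returns x y)) = 1.
Proof.
move=> recx; suff gen u v : reach (supp mu) u v ->
    P (event Y (returns x u)) = 1 -> P (event Y (returns x v)) = 1.
  by move=> /gen; exact.
elim=> {u v} [//|u s v ps _ IH] recu.
by apply: IH; exact: prob_returns_step.
Qed.

Let walk_return_time x k w :
  return_time (walk Y) x w = Some k.+1 <-> event Y (hits walk_at x k x) w.
Proof. by apply: return_time_hits => n; rewrite walkE. Qed.

Let measurable_walk_hits x k y : measurable (event Y (hits walk_at x k y)).
Proof. by apply: (measurable_open hY); exact: open_walk_hits. Qed.

Let hwalk x0 := stationary_functional d x0 p_ge0.

Let walk_invariant x0 (f : R -> \bar R) : (forall y, 0 <= f y <= 1) ->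
  stationary p d x0 (fun y => walk_step p y f) = stationary p d x0 f.
Proof.
move=> f01; apply: (stationary_walk x0 p_ge0 p_sum1 p_dvd) => z.
by case/andP: (f01 z).
Qed.

Lemma walk_positive_recurrent x0 : mean mu < +oo ->
  positive_recurrent_on P (walk Y) (C_set mu x0).
Proof.
move=> fin; split; first exact: walk_essential.
move=> x /(C_setE hmu) rx.
apply: (@positive_recurrent_state _ _ _ P _ x
  (fun k y => event Y (hits walk_at x k y)) _ _ _
  (stationary p d x0) (walk_step p)) => //.
- by move=> y; exact: hits_trivIset.
- by move=> f; exact: walk_invariant.
- by move=> y; exact: prob_walk_hits0.
- by move=> k y; exact: prob_walk_hitsS.
- exact: stationary_point_gt0.
- exact: stationary_mass_fin.
Qed.

(** The process of reflections is a subsequence of the walk, so its return to x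
entails a return of the walk. *)
Lemma walk_returns x0 x : in_range p d x0 x -> P (event Y (returns x x)) = 1.
Proof.
move=> rx; have Cx : C_set mu x0 x by exact/C_setE.
have [+ _] := (reflection_positive_recurrent x0).2 x Cx.
have mR k : measurable (event Y (hits reflected_at x k x)).
  by apply: (measurable_open hY); exact: open_reflected_hits.
have rE k w : return_time (reflection_process Y) x w = Some k.+1 <->
    event Y (hits reflected_at x k x) w.
  apply: return_time_hits => n.
  by apply: reflection_processE; exact: in_range_neqN1 rx.
move/(recurrent_stateE
  (H := fun k y => event Y (hits reflected_at x k y)) P rE) => PR.
have mW : measurable (event Y (returns x x)).
  by apply: (measurable_open hY); exact: open_returns.
apply: le_anti; rewrite probability_le1//=.
rewrite -PR; apply: le_measure; rewrite ?inE//; first exact: bigcup_measurable.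
move=> w [k _ [[[|n] [[e _] ez]] _]]; first by [].
by exists n.
Qed.

(** In the Kac formula the visit probabilities are 1 on the class, so the
infinite mass of the invariant measure forces an infinite mean return time. *)
Lemma walk_null_recurrent x0 : mean mu = +oo ->
  null_recurrent_on P (walk Y) (C_set mu x0).
Proof.
move=> inf; split; first exact: walk_essential.
move=> x /(C_setE hmu) rx; have recx := walk_returns rx.
split.
  apply/(recurrent_stateE
    (H := fun k y => event Y (hits walk_at x k y)) P (walk_return_time x)).
  by rewrite -returnsE.
have Kac : stationary p d x0 (fun y => P (\bigcup_k event Y (hits walk_at x k y))) =
    stationary p d x0 (fun z => ind (z == x)) * mean_return_time P (walk Y) x.
  apply: (@kac_return_time _ _ _ P _ x
    (fun k y => event Y (hits walk_at x k y)) _ _ _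
    (stationary p d x0) (walk_step p)) => //.
  - by move=> y; exact: hits_trivIset.
  - by move=> f; exact: walk_invariant.
  - by move=> y; exact: prob_walk_hits0.
  - by move=> k y; exact: prob_walk_hitsS.
  - exact: stationary_point_fin.
move: Kac; have -> : stationary p d x0
    (fun y => P (\bigcup_k event Y (hits walk_at x k y))) = +oo.
  rewrite -(stationary_mass_infinite x0 inf); apply: stationary_eq_on => //.
  move=> z rz; rewrite -returnsE.
  exact: prob_returns_reach recx (reach_in_range hmu rx rz).
have pos := stationary_point_gt0 rx.
have := stationary_point_fin x0 p_ge0 p_sum1 d_gt0 x.
case: (stationary p d x0 (fun z => ind (z == x))) pos => [r||]// r0 _.
have : 0 <= mean_return_time P (walk Y) x.
  apply: integral_ge0 => w _; case: (return_time _ _ _) => [n|] /=.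
    by rewrite lee_fin.
  exact: leey.
by case: (mean_return_time P (walk Y) x).
Qed.

End recurrence.

Theorem mainTheorem3 (disp : measure_display) (T : measurableType disp)
    (R : realType) (P : probability T R) (Y : nat -> {RV P >-> nat})
    (mu : probability nat R)
    (hY : iid_with_law Y mu) (hmu : nonconstant mu)
    (hF : (\sum_(0 <= k <oo) (1 - F_mu mu k) ^+ 2 < +oo)%E) :
  (forall x0 : R, 0 <= x0 ->
     positive_recurrent_on P (reflection_process Y) (C_set mu x0)) /\
  ((mean mu < +oo)%E -> forall x0 : R, 0 <= x0 ->
     positive_recurrent_on P (walk Y) (C_set mu x0)) /\
  (mean mu = +oo%E -> forall x0 : R, 0 <= x0 ->
     null_recurrent_on P (walk Y) (C_set mu x0)).
Proof.
split; first by move=> x0 _; exact: reflection_positive_recurrent.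
split=> hmean x0 _; first exact: walk_positive_recurrent.
exact: walk_null_recurrent.
Qed.
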